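(* Let $\gamma>0$ be a constant, let $p\in[1-n^{-\gamma},1]$ and $k\in\mathbb{N}$ be functions of $n$ with $k<\exp(n^{o(1)})$, and let $\mathbf{G}\sim\mathcal{G}(n,p,k)$. Then asymptotically almost surely, every $\mathrm{Res}(\oplus)$ refutation of $\mathrm{BinClique}(\mathbf{G},k)$ of depth $D$ and size $S$ satisfies $$D\sqrt{\log S}\ \ge\ \begin{cases}\Omega(n^{3\gamma/2}) & \text{if }\gamma<1/2,\\[2pt] \Omega\!\left(\dfrac{n^{(1+\gamma)/2}}{\sqrt{\log kn}}\right) & \text{if }1/2\le\gamma<1,\\[4pt] \Omega(n^{1-\varepsilon}) & \text{if }\gamma\ge1,\end{cases}$$ the last case holding for every constant $\varepsilon>0$.
   Context: $\mathcal{G}(n,p,k)$: graph on $V=V_1\sqcup\dots\sqcup V_k$, $|V_i|=n$, in which each pair of vertices in different blocks is an edge independently with probability $p$ and there are no edges within blocks. For a Boolean variable $x$, $(x\neq0)$ denotes $x$ and $(x\neq1)$ denotes $\overline{x}$. For a graph $G$ with vertex set $V$, each vertex identified with its binary representation in $\{0,1\}^{\log|V|}$, the CNF $\mathrm{BinClique}(G,k)$ has variables $x_{i,a}$, $i\in[k]$, $a\in[\log|V|]$, and clauses: for all $i\neq j\in[k]$ and all $v_i\neq v_j\in V$ with $\{v_i,v_j\}\notin E$, the clause $\bigvee_{a}(x_{i,a}\neq v_{i,a})\vee\bigvee_a(x_{j,a}\neq v_{j,a})$; and for all $v\in V$ and $i\neq j\in[k]$, the clause $\bigvee_a(x_{i,a}\neq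 v_a)\vee\bigvee_a(x_{j,a}\neq v_a)$. $\mathrm{Res}(\oplus)$: lines are linear clauses, i.e. disjunctions of equations $f=a$ with $f$ a linear form over $\mathbb{F}_2$ and $a\in\mathbb{F}_2$ (a propositional clause is a linear clause via $x\mapsto (x=1)$, $\overline x\mapsto(x=0)$). A refutation of a CNF $F$ is a sequence of linear clauses ending in the empty clause, each being a clause of $F$ or derived from earlier ones by the resolution rule (from $C\vee(f=1)$ and $D\vee(f=0)$ derive $C\vee D$) or by semantic weakening (from $C$ derive any linear clause $D$ satisfied by every $0/1$ assignment satisfying $C$). Its size is the number of linear clauses; its depth is the maximum number of resolution steps on a path from axioms to the empty clause. ''Asymptotically almost surely'': with probability $1-o(1)$ as $n\to\infty$. *)

(* Defs.v *)
From HB Require Import structures.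
From mathcomp Require Import all_boot all_order all_algebra.
From mathcomp Require Import all_classical all_reals all_analysis.
Set Implicit Arguments. Unset Strict Implicit. Unset Printing Implicit Defensive.
Import Order.TTheory GRing.Theory Num.Theory.
Import numFieldNormedType.Exports.
Local Open Scope set_scope.
Local Open Scope ring_scope.

Section ResXor.
Variable V : finType.

(* a linear form over F_2 is given by its support: f = sum_{x in f} x *)
Definition lform := {set V}.
Definition lequation := (lform * bool)%type.
Definition lclause := {set lequation}.

Definition eval_form (alpha : V -> bool) (f : lform) : bool :=
  \big[addb/false]_(x in f) alpha x.
Definition eval_eq (alpha : V -> bool) (e : lequation) : bool :=
  eval_form alpha e.1 == e.2.
Definition sat_clause (alpha : V -> bool) (C : lclause) : bool :=
  [exists e in C, eval_eq alpha e].

Definition resolvent (C1 C2 Rc : lclause) : Prop :=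
  exists (f : lform) (C D : lclause),
    [/\ C1 = C :|: [set (f, true)], C2 = D :|: [set (f, false)] & Rc = C :|: D].

Definition sem_weakening (C D : lclause) : Prop :=
  forall alpha : V -> bool, sat_clause alpha C -> sat_clause alpha D.

Inductive just := JAxiom | JRes of nat & nat | JWeak of nat.
Definition pline := (lclause * just)%type.
Definition dflt_line : pline := (finset.set0, JAxiom).

Definition valid_line (F : lclause -> Prop) (P : seq pline) (i : nat) : Prop :=
  let C := (nth dflt_line P i).1 in
  match (nth dflt_line P i).2 with
  | JAxiom => F C
  | JRes j l => [/\ (j < i)%N, (l < i)%N &
                  resolvent (nth dflt_line P j).1 (nth dflt_line P l).1 C]
  | JWeak j => (j < i)%N /\ sem_weakening (nth dflt_line P j).1 C
  end.

Definition refutation (F : lclause -> Prop) (P : seq pline) : Prop :=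
  [/\ (0 < size P)%N,
      (forall i, (i < size P)%N -> valid_line F P i) &
      (nth dflt_line P (size P).-1).1 = finset.set0].

Definition proof_size (P : seq pline) : nat := size P.

(* number of resolution steps on the longest path from axioms to line i
   (fuel m; justifications point to earlier lines, so fuel i.+1 suffices) *)
Fixpoint ldepth (P : seq pline) (m i : nat) : nat :=
  match m with
  | 0 => 0
  | m'.+1 =>
    match (nth dflt_line P i).2 with
    | JAxiom => 0
    | JRes j l => (maxn (ldepth P m' j) (ldepth P m' l)).+1
    | JWeak j => ldepth P m' j
    end
  end.

Definition proof_depth (P : seq pline) : nat := ldepth P (size P) (size P).-1.

End ResXor.

Section BinClique.
Variables (N kk : nat).
Definition nbits : nat := up_log 2 N.
Definition BVar := ('I_kk * 'I_nbits)%type.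
Definition vbit (v : 'I_N) (a : 'I_nbits) : bool := odd (v %/ 2 ^ a)%N.
(* the literals (x_{i,a} != v_a), a in [log|V|], as linear equations:
   (x != 0) is x, i.e. (x = 1); (x != 1) is ~x, i.e. (x = 0) *)
Definition neq_lits (i : 'I_kk) (v : 'I_N) : lclause BVar :=
  [set ([set ((i, a) : BVar)], ~~ vbit v a) | a : 'I_nbits].
Definition pair_clause (i : 'I_kk) (v : 'I_N) (j : 'I_kk) (w : 'I_N) :=
  neq_lits i v :|: neq_lits j w.

Definition BinClique (adj : rel 'I_N) (C : lclause BVar) : Prop :=
  (exists (i j : 'I_kk) (vi vj : 'I_N),
      [/\ i != j, vi != vj, ~~ adj vi vj & C = pair_clause i vi j vj]) \/
  (exists (v : 'I_N) (i j : 'I_kk), i != j /\ C = pair_clause i v j v).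
End BinClique.

(* vertex set 'I_(k*n); vertex v lies in block V_(v %/ n) *)
Definition cross_pairs (n kk : nat) : {set ('I_(kk * n) * 'I_(kk * n))} :=
  [set uv : 'I_(kk * n) * 'I_(kk * n) | ((uv.1 < uv.2)%N && ((uv.1 %/ n)%N != (uv.2 %/ n)%N))].
(* a sample omega is the set of (ordered u<v) cross pairs that are edges *)
Definition adj_of (n kk : nat) (omega : {set ('I_(kk * n) * 'I_(kk * n))}) :
  rel 'I_(kk * n) := fun u v => ((u, v) \in omega) || ((v, u) \in omega).

Definition gnpk_prob {R : realType} (n kk : nat) (p : R)
  (E : {set ('I_(kk * n) * 'I_(kk * n))} -> Prop) : R :=
  \sum_(omega in powerset (cross_pairs n kk))
     p ^+ #|omega| * (1 - p) ^+ (#|cross_pairs n kk| - #|omega|)%N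
     * (if `[< E omega >] then 1 else 0).

Definition refutation_lb {R : realType} (n kk : nat)
  (omega : {set ('I_(kk * n) * 'I_(kk * n))}) (bound : R) : Prop :=
  forall P : seq (pline (BVar (kk * n) kk)),
    refutation (BinClique (adj_of omega)) P ->
    bound <= (proof_depth P)%:R * Num.sqrt (ln (proof_size P)%:R).

Local Open Scope classical_set_scope.
Definition aas_lb {R : realType} (p : nat -> R) (k : nat -> nat)
  (f : nat -> R) : Prop :=
  (fun n : nat => @gnpk_prob R n (k n) (p n) (fun omega => @refutation_lb R n (k n) omega (f n)))
    @ \oo --> (1 : R).

(* Main.v *)
(** In a typical graph every vertex has at most [Dl ~ 4 n^(1-gamma)]
non-neighbours in every other block, so that about [m ~ n / (16 Dl) ~ n^gamma]
blocks can be touched before choosing compatible vertices becomes difficult.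
Restrict the i-th vertex to the i-th block. To answer a parity query, touch a
block occurring in it: fix all bits of its vertex except one pivot bit, in such
a way that both values of the pivot bit are compatible with all touched blocks,
and let the equation given by the query determine the pivot bit. Such a walk
from the empty clause never falsifies an axiom, hence the depth is at least [m].

Choosing the vertex and the answer at random (derandomized by conditional
expectations), the walk reaches a given clause whose negation has codimension
[r] on the starting space with probability at most [(2/3)^r]; hence some walk of
[~ m] steps ends in a clause of codimension [O(log S)]. All the other answers
can then be forgotten: [O(log S)] touched blocks suffice to imply the negation
of that clause, by Rado's theorem. Starting again from there, one gets
[~ m / log S] walks of length [~ m], so that [D log S >= Omega(m^2)]; together
with [D >= m] this yields [D sqrt(log S) >= Omega(m^(3/2))]. *)

Require Import Defs.
From HB Require Import structures.
From mathcomp Require Import all_boot all_order all_algebra.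
From mathcomp Require Import all_classical all_reals all_analysis.
From mathcomp Require Import zify ring lra.
Set Implicit Arguments. Unset Strict Implicit. Unset Printing Implicit Defensive.
Import Order.TTheory GRing.Theory Num.Theory.
Import numFieldNormedType.Exports.
Local Open Scope ring_scope.

(** * Linear forms on coordinate spaces and their supports *)

Section CoordinateSpaces.
Import mathcomp.boot.fintype mathcomp.boot.finset.
Variables (K : fieldType) (I : finType).
Local Notation E := {ffun I -> K^o}.
Implicit Types (f g x z : E) (S : {set I}) (N W : {vspace E}).

Definition dot f x : K := \sum_i f i * x i.

Lemma dotDl f g x : dot (f + g) x = dot f x + dot g x.
Proof. by rewrite -big_split; apply: eq_bigr => i _; rewrite ffunE mulrDl. Qed.

Lemma dotC f x : dot f x = dot x f.
Proof. by apply: eq_bigr => i _; rewrite mulrC. Qed.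

Lemma dotZl (a : K) f x : dot (a *: f) x = a * dot f x.
Proof. by rewrite /dot big_distrr; apply: eq_bigr => i _; rewrite ffunE; exact/esym/mulrA. Qed.

Lemma dot0l x : dot 0 x = 0.
Proof. by rewrite /dot big1 // => i _; rewrite ffunE mul0r. Qed.

Lemma dot_suml (J : Type) (r : seq J) (P : pred J) (F : J -> E) x :
  dot (\sum_(j <- r | P j) F j) x = \sum_(j <- r | P j) dot (F j) x.
Proof. by elim/big_rec2: _ => [|j y y' _ <-]; rewrite ?dot0l ?dotDl. Qed.

Definition delta i : E := [ffun j => (j == i)%:R].

Lemma deltaE i j : delta i j = (j == i)%:R.
Proof. by rewrite ffunE. Qed.

Lemma dot_delta i x : dot (delta i) x = x i.
Proof.
rewrite /dot (bigD1 i) //= deltaE eqxx mul1r big1 ?addr0 // => j /negPf ji.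
by rewrite deltaE ji mul0r.
Qed.

Lemma sum_delta f : f = \sum_i f i *: delta i.
Proof.
apply/ffunP => j; rewrite sum_ffunE (bigD1 j) //= big1 ?addr0 => [|i ij].
  by rewrite !ffunE eqxx [_ *: _]mulr1.
by rewrite !ffunE eq_sym (negPf ij) [_ *: _]mulr0.
Qed.

(** Zeroing the coordinates in [S] is linear, so the vectors supported in [S] are obtained as the
    kernel [csp S]. *)
Definition kill S f : E := [ffun i => if i \in S then 0 else f i].

Lemma kill_is_linear S : linear (kill S).
Proof.
by move=> a f g; apply/ffunP => i; rewrite !ffunE; case: ifP => // _; rewrite scaler0 addr0.
Qed.
HB.instance Definition _ S := GRing.isLinear.Build K E E _ (kill S) (kill_is_linear S).

Definition csp S : {vspace E} := lker (linfun (kill S)).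

Lemma cspP S f : reflect (forall i, i \notin S -> f i = 0) (f \in csp S).
Proof.
rewrite memv_ker lfunE /=; apply: (iffP eqP) => [fS i iS|fS].
  by have /ffunP/(_ i) := fS; rewrite !ffunE (negPf iS).
by apply/ffunP => i; rewrite !ffunE; case: ifPn => // /fS.
Qed.

Lemma csp_delta S i : (delta i \in csp S) = (i \in S).
Proof.
apply/cspP/idP => [H|iS j jS].
  by apply: contraT => /H /eqP; rewrite deltaE eqxx oner_eq0.
by rewrite deltaE; case: eqP => // ji; rewrite ji iS in jS.
Qed.

Lemma cspS S S' : S \subset S' -> (csp S <= csp S')%VS.
Proof.
by move=> /subsetP sub; apply/subvP => f /cspP fS; apply/cspP => i /(contra (sub i))/fS.
Qed.

Lemma csp_cap S S' : (csp S :&: csp S')%VS = csp (S :&: S').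
Proof.
apply/vspaceP => f; rewrite memv_cap; apply/andP/cspP => [[/cspP f1 /cspP f2] i|H].
  by rewrite inE negb_and => /orP[/f1|/f2].
by split; apply/cspP => i iS; apply: H; rewrite inE negb_and iS ?orbT.
Qed.

Lemma csp0 : csp set0 = 0%VS.
Proof.
apply/vspaceP => f; rewrite memv0; apply/cspP/eqP => [H|-> i _]; last by rewrite ffunE.
by apply/ffunP => i; rewrite ffunE H ?inE.
Qed.

Lemma cspT : csp [set: I] = fullv.
Proof. by apply/vspaceP => f; rewrite memvf; apply/cspP => i; rewrite inE. Qed.

Lemma csp_sum S S' : (csp S + csp S')%VS = csp (S :|: S').
Proof.
apply/eqP; rewrite eqEsubv; apply/andP; split.
  by rewrite subv_add; apply/andP; split; apply: cspS; rewrite ?subsetUl ?subsetUr.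
apply/subvP => f /cspP fS; rewrite (sum_delta f); apply: memv_suml => i _.
have [iS|iS] := boolP (i \in S :|: S'); last by rewrite fS // scale0r mem0v.
apply: memvZ; case/setUP: iS => iS.
  by apply: (subvP (addvSl _ _)); rewrite csp_delta.
by apply: (subvP (addvSr _ _)); rewrite csp_delta.
Qed.

Lemma csp1 i : csp [set i] = <[delta i]>%VS.
Proof.
apply/vspaceP => f; apply/cspP/vlineP => [H|[a ->] j]; last first.
  by rewrite inE !ffunE => /negPf->; rewrite [_ *: _]mulr0.
exists (f i); apply/ffunP => j; rewrite !ffunE; case: eqP => [->|ji].
  by rewrite [_ *: _]mulr1.
by rewrite [_ *: _]mulr0 H // inE; apply/eqP.
Qed.

Lemma delta_neq0 i : delta i != 0.
Proof.
by apply/eqP => /ffunP/(_ i)/eqP; rewrite !ffunE eqxx oner_eq0.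
Qed.

Lemma dim_csp S : \dim (csp S) = #|S|.
Proof.
have [n] := ubnP #|S|; elim: n S => // n IH S leSn.
have [->|[i iS]] := set_0Vmem S; first by rewrite csp0 dimv0 cards0.
rewrite -(setD1K iS) -csp_sum dimv_disjoint_sum; last first.
  rewrite csp_cap; apply/eqP; rewrite -subv0 -csp0; apply: cspS.
  by apply/subsetP => j; rewrite !inE => /andP[/eqP->]; rewrite eqxx.
rewrite csp1 dim_vline delta_neq0 cardsU1 !inE eqxx; congr (_ + _)%N.
by apply: IH; rewrite [in X in (X < _)%N](cardsD1 i) iS in leSn.
Qed.

Lemma dim_fullE : \dim (fullv : {vspace E}) = #|I|.
Proof. by rewrite -cspT dim_csp cardsT. Qed.

(* A functional given on the two summands of a direct sum of spaces of forms
   extends to all forms, hence is the evaluation at some point. *)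
Lemma interp N W x z : (N :&: W = 0)%VS ->
  exists y, (forall f, f \in N -> dot f y = dot f x) /\
            (forall f, f \in W -> dot f y = dot f z).
Proof.
move=> NW.
pose h f := dot (daddv_pi N W f) x + dot (daddv_pi W N f) z.
have hZ f : h f = \sum_i f i * h (delta i).
  rewrite /h {1 2}(sum_delta f) !linear_sum !dot_suml -big_split.
  by apply: eq_bigr => i _; rewrite /= !linearZ !dotZl -mulrDr.
exists [ffun i => h (delta i)].
have dE f : dot f [ffun i => h (delta i)] = h f.
  by rewrite hZ; apply: eq_bigr => i _; rewrite ffunE.
split=> f fN; rewrite dE /h.
  have /daddv_pi_add := NW => /(_ f (subvP (addvSl _ _) _ fN)).
  rewrite daddv_pi_id // -[RHS]addr0 => /addrI ->.
  by rewrite dot0l addr0.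
have WN : (W :&: N = 0)%VS by rewrite capvC.
have /daddv_pi_add := WN => /(_ f (subvP (addvSl _ _) _ fN)).
by rewrite (daddv_pi_id WN) // -[RHS]addr0 => /addrI ->; rewrite dot0l add0r.
Qed.

End CoordinateSpaces.

(** * Independent transversals *)

Section Rado.
Import mathcomp.boot.fintype mathcomp.boot.finset.
Variables (K : fieldType) (B J : finType) (j0 : J).
Local Notation E := {ffun (B * J) -> K^o}.

Definition bsp (S : {set B}) : {vspace E} := csp K [set i | i.1 \in S].

Lemma bspP (S : {set B}) (f : E) :
  reflect (forall b j, b \notin S -> f (b, j) = 0) (f \in bsp S).
Proof.
apply: (iffP (cspP _ _)) => [H b j bS|H [b j]]; first by apply: H; rewrite inE.
by rewrite inE => /H.
Qed.

Lemma bspS (S S' : {set B}) : S \subset S' -> (bsp S <= bsp S')%VS.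
Proof.
by move=> /subsetP sub; apply: cspS; apply/subsetP => i; rewrite !inE => /sub.
Qed.

Lemma bsp_cap (S S' : {set B}) : (bsp S :&: bsp S')%VS = bsp (S :&: S').
Proof. by rewrite /bsp csp_cap; congr csp; apply/setP => i; rewrite !inE. Qed.

(* Rado's theorem on independent transversals: under Hall's condition the
   forms in [L] are determined by one coordinate in each of [\dim L] blocks. *)
Lemma rado (F : {set B}) (L : {vspace E}) :
  (forall W : {set B}, W \subset F -> (\dim (L :&: bsp (~: F :|: W)) <= #|W|)%N) ->
  exists (X : {set B}) (a : B -> J),
    [/\ X \subset F, #|X| = \dim L &
      forall f, f \in L -> (forall b, b \in X -> f (b, a b) = 0) -> f = 0].
Proof.
have [n] := ubnP #|F|; elim: n F L => // n IH F L leFn hall.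
have [L0|Ln0] := eqVneq L 0%VS.
  exists set0, (fun=> j0); rewrite sub0set cards0 L0 dimv0; split=> // f.
  by rewrite memv0 => /eqP.
pose tight (W : {set B}) :=
  [&& W \subset F, W != set0 & \dim (L :&: bsp (~: F :|: W)) == #|W|].
(* By the dimension formula, a dimension below [#|W1 :&: W2|] on the intersection would force one
   above [#|W1 :|: W2|] on the union, against Hall's condition. *)
have tightI W1 W2 b : tight W1 -> tight W2 -> b \in W1 -> b \in W2 -> tight (W1 :&: W2).
  case/and3P=> W1F _ /eqP d1 /and3P[W2F _ /eqP d2] b1 b2; apply/and3P.
  have sub : W1 :&: W2 \subset F by apply: subset_trans (subsetIl _ _) W1F.
  split=> //; first by apply/set0Pn; exists b; rewrite inE b1.
  rewrite eqn_leq hall //=.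
  have capE : (L :&: bsp (~: F :|: W1) :&: (L :&: bsp (~: F :|: W2)) =
               L :&: bsp (~: F :|: W1 :&: W2))%VS.
    by rewrite capvA (capvC _ L) !capvA capvv -capvA bsp_cap setUIr.
  have /(f_equal (fun d => d - #|W1 :|: W2|)%N) :=
    dimv_sum_cap (L :&: bsp (~: F :|: W1)) (L :&: bsp (~: F :|: W2)).
  rewrite capE d1 d2 -cardsUI.
  have : (\dim (L :&: bsp (~: F :|: W1) + L :&: bsp (~: F :|: W2)) <= #|W1 :|: W2|)%N.
    apply: leq_trans (hall _ _); last by rewrite subUset W1F.
    apply: dimvS; rewrite subv_add !subv_cap !capvSl /=.
    by rewrite !(subv_trans (capvSr _ _)) // bspS // setUS // ?subsetUl ?subsetUr.
  lia.
(* [T0] is a minimal tight set, or all of [F] when no set is tight; in both cases a tight set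
   meeting [T0] contains it. *)
have [T0 [TF [g [gL gT gn0]] Tmin]] : exists T0 : {set B}, [/\ T0 \subset F,
    (exists g : E, [/\ g \in L, g \in bsp (~: F :|: T0) & g != 0]) &
    forall W b, tight W -> b \in T0 -> b \in W -> T0 \subset W].
  have [[W tW]|no] := pickP tight; last first.
    exists F; split=> //; last by move=> W b; rewrite no.
    exists (vpick L); rewrite memv_pick vpick0; split=> //.
    by apply/bspP => b j; rewrite !inE orNb.
  have [T0 /minsetP[tT0 Tmin] _] := minset_exists tW.
  have [TF Tn0 /eqP dT] := and3P tT0.
  exists T0; split=> //.
    exists (vpick (L :&: bsp (~: F :|: T0))).
    have := memv_pick (L :&: bsp (~: F :|: T0)); rewrite memv_cap => /andP[-> ->].
    by rewrite vpick0 -dimv_eq0 dT cards_eq0.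
  move=> W' b tW' bT bW'; have tI := tightI _ _ _ tT0 tW' bT bW'.
  by have /setIidPl := Tmin _ tI (subsetIl _ _).
(* Hall's condition for the empty set excludes nonzero forms of [L] supported outside [F], so [g] is
   nonzero somewhere in a block of [T0]. *)
have [b [j [bT gbj]]] : exists b j, b \in T0 /\ g (b, j) != 0.
  have gF : g \notin bsp (~: F).
    apply: contraNN gn0 => gF; have := hall _ (sub0set F).
    rewrite setU0 cards0 leqn0 dimv_eq0 => /eqP LF0.
    by rewrite -memv0 -LF0 memv_cap gL.
  have [|no] := pickP [pred i : B * J | (i.1 \in T0) && (g i != 0)].
    by case=> b j /= /andP[bT gbj]; exists b, j.
  case/negP: gF; apply/bspP => b j bF; apply/eqP.
  have [bT|bT] := boolP (b \in T0); first by have := no (b, j); rewrite /= bT /= => /negbFE.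
  by move/bspP: gT => ->//; rewrite inE negb_or bT andbT.
have gTW W : tight W -> b \in W -> g \in bsp (~: F :|: W).
  by move=> tW /(Tmin W b tW bT) T0W; apply: (subvP (bspS (setUS _ T0W))).
pose L' := (L :&: csp K [set~ (b, j)])%VS.
have L'P f : (f \in L') = (f \in L) && (f (b, j) == 0).
  rewrite memv_cap; congr (_ && _); apply/cspP/eqP => [->//|f0 i]; first by rewrite !inE eqxx.
  by rewrite !inE negbK => /eqP->.
have gL' : g \notin L' by rewrite L'P negb_and gbj orbT.
have bF : b \in F by apply: (subsetP TF).
have dL : \dim L = (\dim L').+1.
  have LE : L = (<[g]> + L')%VS.
    apply/eqP; rewrite eqEsubv subv_add capvSl -memvE gL !andbT.
    apply/subvP => f fL; rewrite -(subrK ((f (b, j) / g (b, j)) *: g) f) addrC.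
    apply: memv_add; first by rewrite memvZ // memv_line.
    rewrite L'P memvB ?memvZ //= !ffunE subr_eq0 eq_sym.
    by apply/eqP; exact: (mulfVK gbj).
  rewrite {1}LE dimv_disjoint_sum; first by rewrite dim_vline gn0.
  apply/eqP; rewrite -subv0; apply/subvP => f; rewrite memv_cap => /andP[/vlineP[a ->]].
  have [->|a0] := eqVneq a 0; first by rewrite scale0r !mem0v.
  by move=> /(memvZ a^-1); rewrite scalerA mulVf // scale1r (negPf gL').
(* Hall's condition survives the removal of [b]: it could fail only if [b |: W] is tight, but then
   this set contains [T0], and losing [g] in passing to [L'] lowers the dimension. *)
have := IH (F :\ b) L'; case.
- by rewrite (cardsD1 b) bF in leFn.
- move=> W WF.
  have bW : b \notin W by apply: contraTN WF => bW; apply/negP => /subsetP/(_ b bW); rewrite !inE eqxx.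
  have bWF : b |: W \subset F.
    by rewrite subUset sub1set bF (subset_trans WF) // subD1set.
  have FE : ~: (F :\ b) :|: W = ~: F :|: (b |: W).
    by apply/setP => c; rewrite !inE negb_and negbK; case: (c == b); rewrite ?orbT.
  have sub : (L' :&: bsp (~: (F :\ b) :|: W) <= L :&: bsp (~: F :|: (b |: W)))%VS.
    by rewrite FE capvS // capvSl.
  have := hall _ bWF; rewrite cardsU1 bW add1n leq_eqVlt => /orP[/eqP dT|].
    rewrite -ltnS -dT (ltn_leqif (dimv_leqif_sup sub)); apply/negP => /subvP/(_ g).
    rewrite memv_cap gL gTW ?setU11 //; last first.
      apply/and3P; split=> //; last by rewrite dT cardsU1 bW.
      by apply/set0Pn; exists b; rewrite setU11.
    by move=> /(_ isT); rewrite memv_cap (negPf gL').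
  by rewrite ltnS; apply: leq_trans; apply: dimvS.
move=> X [a [XF dX aX]].
have bX : b \notin X by apply: contraTN XF => bX; apply/negP => /subsetP/(_ b bX); rewrite !inE eqxx.
exists (b |: X), (fun c => if c == b then j else a c); split.
- by rewrite subUset sub1set bF (subset_trans XF) // subD1set.
- by rewrite cardsU1 bX dX dL.
- move=> f fL H; apply: aX.
    by rewrite L'P fL; apply/eqP; have := H b (setU11 _ _); rewrite eqxx.
  move=> c cX; have := H c (setU1r _ cX).
  by case: eqP => // cb; rewrite -cb cX in bX.
Qed.
End Rado.

(** * Walks through a refutation *)

Section Core.
Import mathcomp.boot.fintype mathcomp.boot.finset.
Variables (K : finFieldType) (B J : finType) (j0 : J).
Local Notation E := {ffun (B * J) -> K^o}.
Local Notation V := {ffun J -> K}.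
Local Notation csp := (@csp K (B * J)%type).
Local Notation bsp := (@bsp K B J).
Local Notation delta := (@delta K (B * J)%type).
Implicit Types (b c : B) (a j : J) (u v w : V) (x y z f g : E) (T X : {set B}) (pv p : B -> J).
Hypothesis cardK : #|K| = 2%N.
(* [cmp b c u w]: the vertex of block [b] with low bits [u] is adjacent to the
   vertex of block [c] with low bits [w]. *)
Variables (cmp : B -> B -> V -> V -> bool) (Dl m : nat).
Hypothesis cmpC : forall b c u w, cmp b c u w = cmp c b w u.
Hypothesis cmp_deg : forall b c w, b != c -> (#|[set u | ~~ cmp b c u w]| <= Dl)%N.
Hypothesis m_small : (16 * (m * Dl) <= 2 ^ #|J|)%N.

(** * Vertices compatible with the touched blocks *)

Definition blk (x : E) (b : B) : V := [ffun j => x (b, j)].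
Definition off (a : J) (u v : V) := [forall j, (j == a) || (u j == v j)].
Definition flip (a : J) (e : K) (u : V) : V := [ffun j => u j + (if j == a then e else 0)].

Lemma offP a u v : reflect (forall j, j != a -> u j = v j) (off a u v).
Proof.
apply: (iffP forallP) => H j; first by move=> /negPf ja; move: (H j); rewrite ja => /eqP.
by case: eqP => //= /eqP/H ->.
Qed.

Lemma off_refl a u : off a u u. Proof. exact/offP. Qed.

Lemma off_trans a u v w : off a u v -> off a v w -> off a u w.
Proof. by move=> /offP H1 /offP H2; apply/offP => j ja; rewrite H1 // H2. Qed.

Lemma off_flip a u v : off a u v -> exists e, u = flip a e v.
Proof.
move=> /offP H; exists (u a - v a); apply/ffunP => j; rewrite ffunE.
by have [->|/H->] := eqVneq j a; rewrite ?addr0 // addrC subrK.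
Qed.

Lemma flipK a e : cancel (flip a e) (flip a (- e)).
Proof. by move=> u; apply/ffunP => j; rewrite !ffunE -addrA; case: eqP => _; rewrite ?subrr ?oppr0 ?addr0. Qed.

(* Whatever values the pivot bits of the touched blocks take, the chosen
   vertices are pairwise compatible. *)
Definition ok (T : {set B}) (pv : B -> J) (x : E) := forall b c u w,
  b \in T -> c \in T -> b != c ->
  off (pv b) u (blk x b) -> off (pv c) w (blk x c) -> cmp b c u w.

Definition good (T : {set B}) (pv : B -> J) (x : E) b a (u : V) :=
  [forall c in T, forall u', forall w,
     off a u' u ==> off (pv c) w (blk x c) ==> cmp b c u' w].

Lemma goodP T pv x b a u : reflect (forall c u' w, c \in T -> off a u' u ->
   off (pv c) w (blk x c) -> cmp b c u' w) (good T pv x b a u).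
Proof.
apply: (iffP 'forall_in_forallP) => [H c u' w cT h1 h2|H c cT u'].
  by have /forallP/(_ w) := H c cT u'; rewrite h1 h2.
by apply/forallP => w; apply/implyP => h1; apply/implyP; apply: H.
Qed.

Lemma ok_off T pv x y :
  (forall b, b \in T -> off (pv b) (blk y b) (blk x b)) -> ok T pv x -> ok T pv y.
Proof.
move=> H okx b c u w bT cT bc hu hw.
by apply: okx => //; apply: off_trans (H _ _).
Qed.

(** Union bound over a touched block and the shifts of the two pivot bits: each of the at most
    [4 * m] cases excludes at most [Dl] vertices, in total at most a quarter of all by [m_small]. *)
Lemma card_bad T pv x b a : b \notin T -> (#|T| <= m)%N ->
  (4 * #|[set u | ~~ good T pv x b a u]| <= 2 ^ #|J|)%N.
Proof.
move=> bT Tm.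
pose F (i : B * (K * K)) :=
  [set u | ~~ cmp b i.1 (flip a i.2.1 u) (flip (pv i.1) i.2.2 (blk x i.1))].
have sub : [set u | ~~ good T pv x b a u] \subset
    \bigcup_(i in [set i : B * (K * K) | i.1 \in T]) F i.
  apply/subsetP => u; rewrite inE negb_forall_in => /exists_inP[c cT].
  rewrite negb_forall => /existsP[u']; rewrite negb_forall => /existsP[w].
  rewrite !negb_imply => /and3P[/off_flip[e1 ->] /off_flip[e2 ->] nc].
  by apply/bigcupP; exists (c, (e1, e2)); rewrite !inE.
have cF i : i.1 \in T -> (#|F i| <= Dl)%N.
  move=> iT; have bi : b != i.1 by apply: contraNneq bT => ->.
  have := cmp_deg (flip (pv i.1) i.2.2 (blk x i.1)) bi; apply: leq_trans.
  rewrite -(card_imset _ (can_inj (flipK a i.2.1))); apply: subset_leq_card.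
  by apply/subsetP => _ /imsetP[u + ->]; rewrite !inE.
have : (#|[set u | ~~ good T pv x b a u]| <= #|T| * 4 * Dl)%N.
  apply: leq_trans (subset_leq_card sub) _.
  have -> : (#|T| * 4 * Dl = \sum_(i in [set i : B * (K * K) | i.1 \in T]) Dl)%N.
    rewrite sum_nat_const; congr (_ * _)%N; have -> : 4%N = #|[set: K * K]|.
      by rewrite cardsT card_prod cardK.
    by rewrite -cardsX; apply: eq_card => -[c e]; rewrite !inE andbT.
  apply: (@leq_trans (\sum_(i in [set i : B * (K * K) | i.1 \in T]) #|F i|)%N).
    elim/big_rec2: _ => [|i S y _ h]; first by rewrite cards0.
    by apply: leq_trans (leq_card_setU _ _) _; rewrite leq_add2l.
  by apply: leq_sum => i; rewrite inE => /cF.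
move=> h; apply: leq_trans m_small.
have : (#|T| * Dl <= m * Dl)%N by rewrite leq_mul2r Tm orbT.
nia.
Qed.

Lemma ex_good T pv x b a : b \notin T -> (#|T| <= m)%N -> exists u, good T pv x b a u.
Proof.
move=> bT Tm; apply/existsP; apply: contraT; rewrite negb_exists => /forallP H.
have := card_bad pv x a bT Tm; have -> : [set u | ~~ good T pv x b a u] = setT.
  by apply/setP => u; rewrite !inE H.
rewrite cardsT card_ffun cardK; have : (0 < 2 ^ #|J|)%N by rewrite expn_gt0.
lia.
Qed.

Lemma ok_add T pv p x b u : b \notin T -> (forall c, c \in T -> p c = pv c) ->
  ok T pv x -> good T pv x b (p b) u ->
  ok (T :|: [set b]) p [ffun i => if i.1 \in [set b] then u i.2 else x i].
Proof.
set z := finfun _ => bT pE okx /goodP gP.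
have zb : blk z b = u by apply/ffunP => j; rewrite !ffunE /= set11.
have zE c : c != b -> blk z c = blk x c.
  by move=> /negPf cb; apply/ffunP => j; rewrite !ffunE /= inE cb.
have Tb c : c \in T -> c != b by move=> cT; apply: contraNneq bT => <-.
move=> c d v w; rewrite !in_setU !in_set1.
move=> /orP[cT|/eqP->] /orP[dT|/eqP->].
- by rewrite !pE // !zE ?Tb //; exact: okx.
- by rewrite pE // zE ?Tb // zb => cb h1 h2; rewrite cmpC; apply: gP.
- by rewrite zb (pE d) // zE ?Tb // => bd h1 h2; apply: gP.
- by rewrite eqxx.
Qed.

(** Greedy choice: as long as at most [m] blocks are touched, [ex_good] supplies a compatible vertex
    for the next block of [X]. *)
Lemma ok_extend T X pv p x : [disjoint X & T] -> (#|T| + #|X| <= m)%N ->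
  (forall b, b \in T -> p b = pv b) -> ok T pv x ->
  exists y, (forall b j, b \notin X -> y (b, j) = x (b, j)) /\ ok (T :|: X) p y.
Proof.
have [n] := ubnP #|X|; elim: n X => // n IH X leXn dis card_le pvE okx.
have [->|[b bX]] := set_0Vmem X.
  exists x; split=> //; rewrite setU0 => b c u w bT cT bc; rewrite !pvE //.
  exact: okx.
have bT : b \notin T by rewrite (disjointFr dis bX).
have [|||||y [yE oky]] := IH (X :\ b).
- by rewrite [in X in (X < _)%N](cardsD1 b) bX in leXn.
- by apply: disjointWl dis; apply: subD1set.
- by apply: leq_trans card_le; rewrite leq_add2l subset_leq_card // subD1set.
- by [].
- by [].
have bTX : b \notin T :|: X :\ b by rewrite !inE eqxx (negPf bT).
have cTX : (#|T :|: X :\ b| <= m)%N.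
  apply: leq_trans card_le; apply: leq_trans (leq_card_setU _ _) _.
  by rewrite leq_add2l subset_leq_card // subD1set.
have [u gu] := ex_good p y (p b) bTX cTX.
exists [ffun i => if i.1 \in [set b] then u i.2 else y i]; split.
  move=> c j cX; rewrite ffunE in_set1 /=; case: eqP => [cb|_]; first by rewrite cb bX in cX.
  by apply: yE; rewrite inE negb_and cX orbT.
have -> : T :|: X = (T :|: X :\ b) :|: [set b].
  by rewrite -setUA (setUC (X :\ b)) setD1K.
exact: (ok_add (pv := p)).
Qed.

(* The points [z] with [dot f z = dot f (tx s)] for all [f] in [tM s] form an
   affine space; by [valid] the bits of the blocks outside [tT s] are free
   coordinates on it, and a block in [tT s] is constant up to its pivot bit. *)
Record state := State { tT : {set B}; pv : B -> J; tM : {vspace E}; tx : E }.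

Definition valid s :=
  [/\ (tM s :&: bsp (~: tT s) = 0)%VS,
      (\dim (tM s) + #|~: tT s| * #|J| = #|B| * #|J|)%N,
      forall b j, b \in tT s -> j != pv s b -> delta (b, j) \in tM s
    & ok (tT s) (pv s) (tx s)].

Definition sat s (z : E) := [forall f, (f \in tM s) ==> (dot f z == dot f (tx s))].

Lemma satP s z : reflect (forall f, f \in tM s -> dot f z = dot f (tx s)) (sat s z).
Proof. by apply: (iffP 'forall_implyP) => H f /H/eqP. Qed.

(** The affine space of [s'] lies in that of [s], and touched blocks stay touched with the same
    pivots. *)
Definition ext s s' :=
  [/\ tT s \subset tT s', (tM s <= tM s')%VS, sat s (tx s')
    & forall b, b \in tT s -> pv s' b = pv s b].

Lemma ext_refl s : ext s s.
Proof. by split=> //; apply/satP. Qed.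

Lemma ext_trans s1 s2 s3 : ext s1 s2 -> ext s2 s3 -> ext s1 s3.
Proof.
move=> [T12 M12 /satP x12 p12] [T23 M23 /satP x23 p23]; split.
- exact: subset_trans T23.
- exact: subv_trans M23.
- by apply/satP => f fM; rewrite x23 ?x12 //; apply: (subvP M12).
- by move=> b bT; rewrite p23 ?p12 //; apply: (subsetP T12).
Qed.

Lemma ext_sat s s' z : ext s s' -> sat s' z -> sat s z.
Proof.
move=> [_ M12 /satP x12 _] /satP H; apply/satP => f fM; rewrite H ?x12 //.
exact: (subvP M12).
Qed.

(** * Touching blocks *)

Definition pivoff (X : {set B}) (p : B -> J) : {vspace E} :=
  csp [set i | (i.1 \in X) && (i.2 != p i.1)].

Lemma pivoffP X p (f : E) : f \in pivoff X p ->
  forall b j, (b \notin X) || (j == p b) -> f (b, j) = 0.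
Proof.
by move=> /cspP H b j bj; apply: H; rewrite inE /= negb_and negbK.
Qed.

Lemma card_pivots X p : #|[set i : B * J | (i.1 \in X) && (i.2 == p i.1)]| = #|X|.
Proof.
rewrite -(card_imset X (f := fun b => (b, p b))); last by move=> b c [].
apply: eq_card => -[b j]; rewrite !inE /=.
apply/andP/imsetP => [[bX /eqP->]|[c cX [-> ->]]]; first by exists b.
by rewrite cX eqxx.
Qed.

Lemma pivoff_dim X p : (\dim (pivoff X p) + #|X| = #|X| * #|J|)%N.
Proof.
rewrite dim_csp -cardsT -cardsX -(cardsID [set i | i.2 == p i.1] (setX X setT)) addnC.
rewrite -(card_pivots X p); congr (_ + _)%N; apply: eq_card => -[b j].
  by rewrite !inE /= andbT.
by rewrite !inE /= andbT andbC.
Qed.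

Definition touch s X p L x' :=
  State (tT s :|: X) (fun b => if b \in X then p b else pv s b)
    (tM s + L + pivoff X p)%VS x'.

(** Since a form of [L] is determined by its pivot coordinates, [tM s], [L] and the non-pivot forms
    of [X] are independent, and [interp], applied twice, finds a point with values from [tx s], [w]
    and [z] on them. In the dimension count the [#|X|] forms of [L] stand in for the pivot bits. *)
Lemma touch_valid s (X : {set B}) (p : B -> J) (L : {vspace E}) (z w : E) :
  valid s -> X \subset ~: tT s -> (L <= bsp (~: tT s))%VS -> \dim L = #|X| ->
  (forall f, f \in L -> (forall b, b \in X -> f (b, p b) = 0) -> f = 0) ->
  ok (tT s :|: X) (fun b => if b \in X then p b else pv s b)
    [ffun i => if i.1 \in X then z i else tx s i] ->
  exists x', let s' := touch s X p L x' in
    [/\ valid s', ext s s', forall f, f \in L -> dot f x' = dot f w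
      & forall f, f \in pivoff X p -> dot f x' = dot f z].
Proof.
move=> [V1 dM V2 V3] XT LT dL det okz.
have DT : (pivoff X p <= bsp (~: tT s))%VS.
  by apply: cspS; apply/subsetP => i; rewrite !inE => /andP[/(subsetP XT)]; rewrite inE.
have M0 (f : E) : f \in tM s -> f \in bsp (~: tT s) -> f = 0.
  by move=> f1 f2; apply/eqP; rewrite -memv0 -V1 memv_cap f1.
have ML : (tM s :&: L = 0)%VS.
  by apply/eqP; rewrite -subv0 -V1 capvS.
have MLD : ((tM s + L) :&: pivoff X p = 0)%VS.
  apply/eqP; rewrite -subv0; apply/subvP => f; rewrite memv_cap memv0.
  case/andP=> /memv_addP[f1 f1M [f2 f2L ->]] fD.
  have f10 : f1 = 0.
    apply: M0 => //; rewrite -(addrK f2 f1); apply: memvB; [exact: (subvP DT)|exact: (subvP LT)].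
  rewrite f10 add0r in fD *; apply/eqP; apply: det => // b bX.
  by apply: (pivoffP fD); rewrite eqxx orbT.
have [w1 [w1M w1L]] := interp (tx s) w ML.
have [x' [x'ML x'D]] := interp w1 z MLD.
have x'M f : f \in tM s -> dot f x' = dot f (tx s).
  by move=> fM; rewrite x'ML ?w1M //; apply: (subvP (addvSl _ _)).
have x'L f : f \in L -> dot f x' = dot f w.
  by move=> fL; rewrite x'ML ?w1L //; apply: (subvP (addvSr _ _)).
have XnT b : b \in tT s -> (b \in X) = false.
  by move=> bT; apply: contraTF bT => /(subsetP XT); rewrite inE.
have e : ext s (touch s X p L x').
  split=> /=; first exact: subsetUl.
  - by rewrite -addvA addvSl.
  - exact/satP.
  - by move=> b /XnT ->.
have V2' b j : b \in tT s :|: X -> j != (if b \in X then p b else pv s b) ->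
    delta (b, j) \in (tM s + L + pivoff X p)%VS.
  case/setUP=> bT; rewrite ?bT ?XnT // => ja.
    by rewrite -addvA; apply: (subvP (addvSl _ _)); apply: V2.
  by apply: (subvP (addvSr _ _)); rewrite csp_delta inE bT.
exists x'; split=> //; split=> //=.
(* The three summands vanish in turn: the first by validity of [s], the second because the third is
   zero at the pivots, the third because it is supported on [X]. *)
- apply/eqP; rewrite -subv0; apply/subvP => f; rewrite memv_cap memv0.
  case/andP=> /memv_addP[g /memv_addP[f1 f1M [f2 f2L ->]] [f3 f3D ->]] fT.
  have fT' : f1 + f2 + f3 \in bsp (~: tT s).
    by apply: (subvP (bspS _ _ _)) fT; rewrite setCS subsetUl.
  have f10 : f1 = 0.
    apply: M0 => //; rewrite -(addrK f2 f1); apply: memvB; last exact: (subvP LT).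
    by rewrite -(addrK f3 (f1 + f2)); apply: memvB => //; apply: (subvP DT).
  rewrite f10 add0r in fT *.
  have f20 : f2 = 0.
    apply: det => // b bX; have := bspP _ _ fT b (p b).
    rewrite !inE bX orbT /= => /(_ isT); rewrite ffunE (pivoffP f3D) ?eqxx ?orbT //.
    by rewrite addr0.
  rewrite f20 add0r in fT *; apply/eqP/ffunP => -[b j]; rewrite ffunE.
  have [bX|bX] := boolP (b \in X); last by rewrite (pivoffP f3D) // bX.
  by apply: (bspP _ _ fT); rewrite !inE bX orbT.
- rewrite dimv_disjoint_sum // dimv_disjoint_sum // dL.
  have := pivoff_dim X p; have := dM.
  have -> : ~: (tT s :|: X) = ~: tT s :\: X by rewrite setCU setDE.
  have := cardsID X (~: tT s); have /setIidPr -> := XT.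
  move=> <-; rewrite mulnDl => h1 h2.
  by rewrite -h1 -h2 [(\dim (pivoff X p) + _)%N]addnC !addnA.
- apply: ok_off okz => b bTX /=; apply/offP => j ja; rewrite !ffunE /=.
  have := V2' b j bTX ja; case/setUP: bTX => bX; rewrite ?bX ?XnT // in ja *.
    by rewrite -dot_delta x'M ?dot_delta // V2.
  by move=> _; rewrite -dot_delta x'D ?dot_delta // csp_delta inE bX.
Qed.

(** A right inverse of the coefficient matrix moves a solution to any other right-hand side; these
    translations map [K^n] times [Q] injectively into all vectors. *)
Lemma count_sols n (lam : 'I_n -> V) (c : 'I_n -> K) (Q : {set V}) :
  (forall r : 'rV[K]_n, (forall j, \sum_i r 0 i * lam i j = 0) -> r = 0) ->
  (forall u, u \in Q -> forall i, \sum_j lam i j * u j = c i) ->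
  (2 ^ n * #|Q| <= 2 ^ #|J|)%N.
Proof.
move=> free sol.
pose A : 'M[K]_(n, #|J|) := \matrix_(i, j) lam i (enum_val j).
have Afree : row_free A.
  apply: inj_row_free => r rA; apply: free => j.
  have e0 : (r *m A) 0 (enum_rank j) = 0 by rewrite rA mxE.
  by rewrite -[RHS]e0 mxE; apply: eq_bigr => i _; rewrite mxE enum_rankK.
pose h (q : 'cV[K]_n * V) : V := [ffun j => q.2 j + (pinvmx A *m q.1) (enum_rank j) 0].
have hA t u i : u \in Q -> \sum_j lam i j * h (t, u) j = c i + t i 0.
  move=> uQ; under eq_bigr do rewrite ffunE mulrDr.
  rewrite big_split /= sol //; congr (_ + _).
  have := mulmxA A (pinvmx A) t; rewrite mulmxVp // mul1mx => /matrixP/(_ i 0) <-.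
  rewrite mxE (reindex enum_rank) /=; last exact/onW_bij/enum_rank_bij.
  by apply: eq_bigr => j _; rewrite [A _ _]mxE enum_rankK.
have h_inj : {in setX setT Q &, injective h}.
  move=> [t u] [t' u']; rewrite !inE /= => uQ u'Q hE.
  have tE : t = t'.
    apply/matrixP => i k; rewrite (ord1 k); apply: (@addrI _ (c i)).
    by rewrite -(hA t u) // -(hA t' u') // hE.
  congr (_, _) => //; rewrite tE in hE; apply/ffunP => j.
  by have /ffunP/(_ j) := hE; rewrite !ffunE => /addIr.
have := max_card (h @: setX setT Q).
by rewrite card_in_imset // cardsX cardsT card_mx muln1 card_ffun cardK.
Qed.

(** * Falsified clauses and their potential *)

Variable lines : nat -> seq (E * K).

(* [lines q] lists the equations stating that clause [q] is falsified. *)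
Definition fals q z := all (fun e => dot e.1 z == e.2) (lines q).
Definition forms q : {vspace E} := <<map fst (lines q)>>%VS.

Lemma fals_forms q z y : fals q z -> fals q y -> forall f, f \in forms q -> dot f z = dot f y.
Proof.
move=> /allP fz /allP fy f fq; rewrite (coord_span (X := in_tuple _) fq) !dot_suml; apply: eq_bigr => i _.
rewrite !dotZl; congr (_ * _); set e := nth _ _ _.
have : e \in map fst (lines q) by rewrite mem_nth.
by case/mapP => e' e'q ->; rewrite (eqP (fz _ e'q)) (eqP (fy _ e'q)).
Qed.

Lemma fals_of_forms q z y : fals q z -> (forall f, f \in forms q -> dot f y = dot f z) -> fals q y.
Proof.
move=> /allP fz H; apply/allP => e ec; rewrite H ?fz //.
by apply: memv_span; apply: map_f.
Qed.

(** A form of clause [q] outside [tM s] could be given another value by [interp] without leaving the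
    affine space of [s]. *)
Lemma fals_sub s q : (forall z, sat s z -> fals q z) -> (forms q <= tM s)%VS.
Proof.
move=> H; apply/span_subvP => _ /mapP[e ec ->]; apply: contraT => eM.
have Me : (tM s :&: <[e.1]> = 0)%VS.
  apply/eqP; rewrite -subv0; apply/subvP => f; rewrite memv_cap => /andP[fM /vlineP[a fE]].
  have [a0|a0] := eqVneq a 0; first by rewrite fE a0 scale0r mem0v.
  by have := memvZ a^-1 fM; rewrite fE scalerA mulVf // scale1r (negPf eM).
have [i ei] : exists i, e.1 i != 0.
  apply/existsP; apply: contraNT eM; rewrite negb_exists => /forallP e0.
  have -> : e.1 = 0 by apply/ffunP => i; rewrite ffunE; apply/eqP; rewrite -[_ == _]negbK.
  exact: mem0v.
have [y [yM ye]] := interp (tx s) (tx s + delta i) Me.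
have sy : sat s y by apply/satP.
have /allP/(_ e ec)/eqP h1 := H y sy.
have /allP/(_ e ec)/eqP h2 := H (tx s) (introT (satP _ _) (fun _ _ => erefl)).
move: h1; rewrite ye ?memv_line // dotC dotDl dot_delta dotC h2 => /eqP.
by rewrite -[eqbRHS]addr0 (inj_eq (addrI _)) (negPf ei).
Qed.

(** The codimension that falsifying [q] has inside the affine space of [s]. *)
Definition rank s q := (\dim (forms q + tM s)%VS - \dim (tM s))%N.

(** A pessimistic estimator of the probability that a random walk from [s] forces [q] to be false:
    it equals 1 once [q] is forced false, and touching a block does not raise it on average. *)
Definition phi s q : rat :=
  if [exists z, sat s z && fals q z] then (2%:R / 3%:R) ^+ rank s q else 0.

(* The answers that keep clause [q] falsifiable and lower its rank by [e > 0] are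
   at most a fraction [2^-e] of all, hence [(4/3) 2^-e <= (2/3)^e] of the good ones. *)
Lemma phi_avg s b a g q (P : {set V}) (x' : V -> E) :
  let s' u := touch s [set b] (fun=> a) <[g]>%VS (x' u) in
  (forall u, u \in P -> [/\ ext s (s' u), dot g (x' u) = u a &
     forall j, j != a -> x' u (b, j) = u j]) ->
  (3 * 2 ^ #|J| <= 4 * #|P|)%N ->
  \sum_(u in P) phi (s' u) q <= #|P|%:R * phi s q.
Proof.
move=> s' x'P cP.
pose M' := (tM s + <[g]> + pivoff [set b] (fun=> a))%VS.
have MM' : (tM s <= M')%VS by rewrite /M' -addvA addvSl.
pose r' := (\dim (forms q + M')%VS - \dim M')%N.
pose Q := [set u in P | [exists z, sat (s' u) z && fals q z]].
have -> : \sum_(u in P) phi (s' u) q = #|Q|%:R * (2%:R / 3%:R) ^+ r'.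
  rewrite mulr_natl -sumr_const big_mkcond [RHS]big_mkcond /=.
  by apply: eq_bigr => u _; rewrite /phi inE; case: (u \in P).
rewrite /phi; case: ifPn => [/existsP[z0 /andP[sz0 fz0]]|no]; last first.
  suff -> : Q = set0 by rewrite cards0 mul0r mulr0.
  apply/setP => u; rewrite !inE; apply: contraNF no => /andP[uP /existsP[z /andP[sz fz]]].
  by apply/existsP; exists z; rewrite fz (ext_sat _ sz) //; case: (x'P u uP).
(* [Kc] collects those consequences of the state and the negated clause whose values the answer
   determines; modulo [tM s] they account for the drop of the rank by [\dim D]. *)
pose Kc := ((forms q + tM s) :&: M')%VS.
have MK : (tM s <= Kc)%VS by rewrite subv_cap addvSr.
pose D := (Kc :\: tM s)%VS.
have rE : rank s q = (r' + \dim D)%N.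
  have h1 := dimv_sum_cap (forms q + tM s) M'.
  rewrite -addvA (addv_idPr MM') -/Kc in h1.
  have h2 : (\dim D + \dim (tM s) = \dim Kc)%N.
    by rewrite -(dimv_cap_compl Kc (tM s)) addnC (capv_idPr MK).
  have h3 : (\dim M' <= \dim (forms q + M'))%N by rewrite dimvS // addvSr.
  have h4 : (\dim (tM s) <= \dim (forms q + tM s))%N by rewrite dimvS // addvSr.
  by rewrite /rank /r'; lia.
(* After the answer [u], [g] has the value [u a] and bit [j] of block [b] the value [u j]. So a form
   of [M'] evaluates to a constant plus a linear form in [u], with coefficients [lm.1]. *)
have decomp f : f \in M' -> exists lm : V * E, lm.2 \in tM s /\
    f = lm.2 + lm.1 a *: g + \sum_(j | j != a) lm.1 j *: delta (b, j).
  case/memv_addP=> _ /memv_addP[f1 f1M [_ /vlineP[k ->] ->]] [d dD ->].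
  exists ([ffun j => if j == a then k else d (b, j)], f1); split=> //=.
  rewrite ffunE eqxx; congr (_ + _); apply/ffunP => -[c j]; rewrite sum_ffunE.
  have [ja|ja] := eqVneq j a.
    rewrite (pivoffP dD) ?ja ?eqxx ?orbT // big1 // => j' j'a.
    by rewrite !ffunE xpair_eqE [a == _]eq_sym (negPf j'a) andbF [_ *: _]mulr0.
  have [cb|cb] := eqVneq c b; last first.
    rewrite (pivoffP dD) ?in_set1 ?cb // big1 // => j' j'a.
    by rewrite !ffunE xpair_eqE (negPf cb) [_ *: _]mulr0.
  rewrite (bigD1 j) //= big1 ?addr0 => [|j' /andP[j'a j'j]].
    by rewrite !ffunE (negPf ja) cb eqxx [_ *: _]mulr1.
  by rewrite !ffunE xpair_eqE [j == _]eq_sym (negPf j'j) andbF [_ *: _]mulr0.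
have DM (i : 'I_(\dim D)) : (vbasis D)`_i \in M'.
  have : (vbasis D)`_i \in D by apply: vbasis_mem; rewrite mem_nth // size_tuple.
  by move/(subvP (diffvSl _ _)); rewrite memv_cap => /andP[].
have DK (i : 'I_(\dim D)) : (vbasis D)`_i \in (forms q + tM s)%VS.
  have : (vbasis D)`_i \in D by apply: vbasis_mem; rewrite mem_nth // size_tuple.
  by move/(subvP (diffvSl _ _)); rewrite memv_cap => /andP[].
have [lm lmP] := fin_all_exists (fun i => decomp _ (DM i)).
pose cst (i : 'I_(\dim D)) : K := dot (vbasis D)`_i z0 - dot (lm i).2 (tx s).
(* Each basis form of [D] constrains the answers in [Q]. The constraints are independent: a
   combination with zero coefficients in [u] lies in [tM s], which meets [D] trivially. *)
have card_Q : (2 ^ \dim D * #|Q| <= 2 ^ #|J|)%N.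
  apply: (count_sols (lam := fun i => (lm i).1) (c := cst)).
    move=> r r0; have rM : \sum_i r 0 i *: (vbasis D)`_i \in tM s.
      have -> : \sum_i r 0 i *: (vbasis D)`_i = \sum_i r 0 i *: (lm i).2.
        apply/eqP; rewrite -subr_eq0 -sumrB.
        have -> : \sum_i (r 0 i *: (vbasis D)`_i - r 0 i *: (lm i).2) =
            \sum_i ((r 0 i * (lm i).1 a) *: g +
                    \sum_(j | j != a) (r 0 i * (lm i).1 j) *: delta (b, j)).
          apply: eq_bigr => i _; have [_ ->] := lmP i.
          rewrite -scalerBr -[(lm i).2 + _ + _]addrA [(lm i).2 + _]addrC addrK scalerDr scalerA; congr (_ + _).
          by rewrite scaler_sumr; apply: eq_bigr => j _; rewrite scalerA.
        rewrite big_split /= -scaler_suml r0 scale0r add0r exchange_big /= big1 // => j _.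
        by rewrite -scaler_suml r0 scale0r.
      by apply: memv_suml => i _; apply: memvZ; case: (lmP i).
    have rD : \sum_i r 0 i *: (vbasis D)`_i \in D.
      by apply: memv_suml => i _; apply/memvZ/vbasis_mem; rewrite mem_nth // size_tuple.
    have : \sum_i r 0 i *: (vbasis D)`_i == 0.
      by rewrite -memv0 -(capv_diff Kc (tM s)) memv_cap rD.
    have /freeP := basis_free (vbasisP D) => fr /eqP/fr r0'.
    by apply/rowP => i; rewrite r0' mxE.
  move=> u; rewrite inE => /andP[uP /existsP[z /andP[sz fz]]] i.
  have [eu gu ju] := x'P u uP; have szs := ext_sat eu sz.
  have z0E : dot (vbasis D)`_i z = dot (vbasis D)`_i z0.
    have /memv_addP[f1 f1q [f2 f2M ->]] := DK i; rewrite !dotDl.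
    by rewrite (fals_forms fz fz0 f1q) (satP _ _ szs f2 f2M) (satP _ _ sz0 f2 f2M).
  have [m2 mE] := lmP i.
  have szM f : f \in M' -> dot f z = dot f (x' u) by exact: (satP _ _ sz).
  rewrite /cst -z0E [in RHS]mE !dotDl dotZl dot_suml (satP _ _ szs) //.
  rewrite -[X in X - _]addrA [X in X - _]addrC addrK.
  rewrite szM ?gu; last by rewrite (subvP (addvSl _ _)) // (subvP (addvSr _ _)) // memv_line.
  rewrite (bigD1 a) //=; congr (_ + _); apply: eq_bigr => j ja.
  rewrite dotZl szM ?dot_delta ?ju //.
  by rewrite (subvP (addvSr _ _)) // csp_delta !inE eqxx.
rewrite rE exprD mulrCA [leLHS]mulrC ler_wpM2l ?exprn_ge0 ?divr_ge0 //.
suff h : (3 ^ \dim D * #|Q| <= 2 ^ \dim D * #|P|)%N.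
  rewrite expr_div_n mulrA ler_pdivlMr ?exprn_gt0 //.
  by rewrite -!natrX -!natrM ler_nat mulnC [leqRHS]mulnC.
(* Without a drop only [Q \subset P] avoids the loss factor 4/3; from [\dim D = 1] on the factor is
   absorbed, with equality at 1. *)
case: (\dim D) card_Q => [_|n hn].
  rewrite !mul1n; apply: subset_leq_card; apply/subsetP => u.
  by rewrite inE => /andP[].
have h1 : (3 ^ n <= 4 ^ n)%N by elim: n {hn} => // n IH; rewrite !expnS leq_mul.
have h2 : (3 * (2 ^ n.+1 * #|Q|) <= 4 * #|P|)%N.
  by apply: leq_trans cP; rewrite leq_mul2l hn.
have h4 : (4 ^ n = 2 ^ n * 2 ^ n)%N by rewrite -expnMn.
have h3 : (3 ^ n * #|Q| <= 4 ^ n * #|Q|)%N by rewrite leq_mul2r h1 orbT.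
have h5 : (2 ^ n * (3 * (2 ^ n.+1 * #|Q|)) <= 2 ^ n * (4 * #|P|))%N by rewrite leq_mul2l h2 orbT.
rewrite !expnS in h2 h5 *; nia.
Qed.

(** * Answering queries *)

Lemma touch1 s b a g u : valid s -> b \notin tT s -> g \in bsp (~: tT s) ->
  g (b, a) != 0 -> good (tT s) (pv s) (tx s) b a u ->
  exists x', let s' := touch s [set b] (fun=> a) <[g]>%VS x' in
    [/\ valid s', ext s s', dot g x' = u a & forall j, j != a -> x' (b, j) = u j].
Proof.
move=> vs bT gT gba gu; have [_ _ _ oks] := vs.
have gn0 : g != 0 by apply: contraNneq gba => ->; rewrite ffunE.
(* At the scaled [delta (b, a)] the form [g] takes the value [u a]: entry [a] of [u] serves as the
   answer, the other entries become the bits of block [b]. *)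
have [|||||x' [v' e' x'L x'D]] := @touch_valid s [set b] (fun=> a) <[g]>%VS
    [ffun i => u i.2] ((u a / g (b, a)) *: delta (b, a)) vs.
- by rewrite sub1set inE.
- by rewrite -memvE.
- by rewrite dim_vline gn0 cards1.
- move=> _ /vlineP[k ->] /(_ b (set11 b)) /eqP; rewrite ffunE.
  by rewrite [_ == _]mulf_eq0 (negPf gba) orbF => /eqP->; rewrite scale0r.
- have /= := @ok_add (tT s) (pv s) (fun c => if c \in [set b] then a else pv s c) (tx s) b u bT.
  rewrite set11 => /(_ _ oks gu) h; apply: ok_off (h _) => [c _|c cT].
    set y := blk _ _; set y' := blk _ _; suff -> : y = y' by exact: off_refl.
    by apply/ffunP => j; rewrite !ffunE /=; case: ifP; rewrite ?ffunE.
  by rewrite in_set1; case: eqP => // cb; rewrite -cb cT in bT.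
- exists x'; split=> // [|j ja].
    by rewrite x'L ?memv_line // dotC dotZl dot_delta divfK.
  rewrite -dot_delta x'D ?csp_delta ?inE ?eqxx // dot_delta ffunE //.
Qed.

Lemma valid_full s : valid s -> (tM s + bsp (~: tT s) = fullv)%VS.
Proof.
case=> V1 dM _ _; apply/eqP; rewrite eqEdim subvf dimv_disjoint_sum // dim_fullE.
rewrite dim_csp card_prod -dM leq_add2l.
have -> : [set i : B * J | i.1 \in ~: tT s] = setX (~: tT s) setT.
  by apply/setP => -[b j]; rewrite !inE andbT.
by rewrite cardsX cardsT leqnn.
Qed.

(** Modulo [tM s] the query is a form [g] in untouched blocks. If it is nonzero, a block in its
    support is touched; by [phi_avg] the average total potential over the good vertices stays below
    1, so some good vertex keeps it there. *)
Lemma query s f (bad : seq nat) : valid s -> (#|tT s| < m)%N ->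
  \sum_(q <- bad) phi s q < 1 ->
  exists s', [/\ valid s', ext s s', (#|tT s'| <= #|tT s|.+1)%N, f \in tM s'
    & \sum_(q <- bad) phi s' q < 1].
Proof.
move=> vs Tm Phi; have := memvf f; rewrite -(valid_full vs).
case/memv_addP=> f1 f1M [g gT fE].
have [g0|[[b a] /= gba]] : g = 0 \/ exists i, g i != 0.
  have [/existsP|no] := boolP [exists i, g i != 0]; first by right.
  left; apply/ffunP => i; rewrite ffunE; apply/eqP; apply: contraNT no => gi.
  by apply/existsP; exists i.
  by exists s; split=> //; [exact: ext_refl|rewrite fE g0 addr0].
have bT : b \notin tT s.
  by apply: contraNN gba => bT; rewrite (bspP _ _ gT) // inE bT.
pose P := [set u | good (tT s) (pv s) (tx s) b a u].
have ex u : exists x', u \in P -> let s' := touch s [set b] (fun=> a) <[g]>%VS x' in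
    [/\ valid s', ext s s', dot g x' = u a & forall j, j != a -> x' (b, j) = u j].
  have [uP|_] := boolP (u \in P); last by exists 0.
  have := uP; rewrite inE => gu; have [x' Hx'] := touch1 vs bT gT gba gu.
  by exists x'.
have [x' Hx'] := fin_all_exists ex.
have cP : (3 * 2 ^ #|J| <= 4 * #|P|)%N.
  have := card_bad (pv s) (tx s) a bT (ltnW Tm).
  have -> : [set u | ~~ good (tT s) (pv s) (tx s) b a u] = ~: P.
    by apply/setP => u; rewrite !inE.
  have := cardsC P; rewrite card_ffun cardK; lia.
pose s' u := touch s [set b] (fun=> a) <[g]>%VS (x' u).
have [u uP Hu] : exists2 u, u \in P & \sum_(q <- bad) phi (s' u) q < 1.
  apply/exists_inP; apply: contraT; rewrite negb_exists_in => /forall_inP no.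
  have e2 : (0 < 2 ^ #|J|)%N by rewrite expn_gt0.
  have P0 : (0 < #|P|)%N by lia.
  have : \sum_(u in P) \sum_(q <- bad) phi (s' u) q <= #|P|%:R * \sum_(q <- bad) phi s q.
    rewrite exchange_big /= mulr_sumr; apply: ler_sum => q _.
    by apply: phi_avg => // u uP; have [] := Hx' u uP.
  have h1 : #|P|%:R <= \sum_(u in P) \sum_(q <- bad) phi (s' u) q :> rat.
    by rewrite -sumr_const; apply: ler_sum => u uP; rewrite leNgt no.
  move=> /(le_trans h1); rewrite -[leLHS]mulr1 ler_pM2l ?ltr0n //.
  by rewrite leNgt Phi.
have [v' e' _ _] := Hx' u uP.
exists (s' u); split=> //=.
  by apply: leq_trans (leq_card_setU _ _) _; rewrite cards1 addn1.
rewrite fE (subvP (addvSl _ _)) // memv_add // memv_line //.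
Qed.

(** With the form [delta (b, j0)] and the pivot [j0], all bits of block [b] get fixed. *)
Lemma touch_block s b : valid s -> (#|tT s| < m)%N ->
  exists s', [/\ valid s', ext s s', (#|tT s'| <= #|tT s|.+1)%N & b \in tT s'].
Proof.
move=> vs Tm; have [bT|bT] := boolP (b \in tT s).
  by exists s; split=> //; exact: ext_refl.
have [u gu] := ex_good (pv s) (tx s) j0 bT (ltnW Tm).
have [||x' [v' e' _ _]] := @touch1 s b j0 (delta (b, j0)) u vs bT _ _ gu.
- by rewrite csp_delta !inE.
- by rewrite deltaE eqxx oner_eq0.
exists (touch s [set b] (fun=> j0) <[delta (b, j0)]>%VS x'); split=> //=.
  by apply: leq_trans (leq_card_setU _ _) _; rewrite cards1 addn1.
by rewrite !inE eqxx orbT.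
Qed.

Lemma touch_set s X : valid s -> (#|tT s| + #|X| <= m)%N ->
  exists s', [/\ valid s', ext s s', (#|tT s'| <= #|tT s| + #|X|)%N & X \subset tT s'].
Proof.
have [n] := ubnP #|X|; elim: n X s => // n IH X s leXn vs cm.
have [->|[b bX]] := set_0Vmem X.
  by exists s; split=> //; [exact: ext_refl|rewrite cards0 addn0|exact: sub0set].
have cX : #|X| = #|X :\ b|.+1 by rewrite [LHS](cardsD1 b) bX.
have [|s1 [v1 e1 c1 b1]] := touch_block b vs; first by lia.
have [|||s2 [v2 e2 c2 X2]] := IH (X :\ b) s1; rewrite ?v1 //; try lia.
exists s2; split=> //; [exact: ext_trans e2|lia|].
have [T12 _ _ _] := e2; rewrite -(setD1K bX) subUset sub1set X2 andbT.
exact: (subsetP T12).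
Qed.

(** * Forgetting all but a few answers *)

Lemma leq_sub_exchange (e u t n d : nat) :
  (u + t <= n)%N -> (e + (n - (u + t)) <= d + (n - u))%N -> (e <= t + d)%N.
Proof. lia. Qed.

(* Among the blocks on which the system [N] puts at least as many equations as
   there are blocks, those of the set [U] of maximal excess keep their values;
   the other equations satisfy Hall's condition, so Rado's theorem provides
   pivots for them in distinct blocks, whose vertices can be chosen freely. *)
Lemma settle s0 s1 (N : {vspace E}) (r := (\dim (N + tM s0) - \dim (tM s0))%N) :
  valid s0 -> valid s1 -> ext s0 s1 -> (N <= tM s1)%VS -> (#|tT s1| + r <= m)%N ->
  exists s', [/\ valid s', ext s0 s', (#|tT s'| <= #|tT s0| + r)%N, (N <= tM s')%VS
    & forall f, f \in N -> dot f (tx s') = dot f (tx s1)].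
Proof.
move=> v0 v1 e01 N1 card1.
have [V1 dM V2 ok0] := v0.
have M0 (f : E) : f \in tM s0 -> f \in bsp (~: tT s0) -> f = 0.
  by move=> f1 f2; apply/eqP; rewrite -memv0 -V1 memv_cap f1.
(* [L] represents [N] modulo [tM s0] by forms in untouched blocks, and has dimension [r]. *)
pose L := ((N + tM s0) :&: bsp (~: tT s0))%VS.
have LT : (L <= bsp (~: tT s0))%VS by exact: capvSr.
have ML : (tM s0 + L = N + tM s0)%VS.
  by rewrite addvC vspace_modr ?addvSr // [(bsp _ + _)%VS]addvC (valid_full v0) capvf.
have dL : \dim L = r.
  rewrite /r -ML dimv_disjoint_sum; first by rewrite addKn.
  by apply/eqP; rewrite -subv0 -V1 capvS.
pose d (U : {set B}) : nat := \dim (L :&: bsp U)%VS.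
have d0 : d set0 = 0%N.
  apply/eqP; rewrite dimv_eq0 -subv0; apply/subvP => f; rewrite memv_cap => /andP[_ f0].
  by rewrite memv0; apply/eqP/ffunP => -[b j]; rewrite ffunE (bspP _ _ f0) // inE.
(* The excess [d U - #|U|], shifted by [#|B|] to stay within [nat]. *)
pose exc (U : {set B}) : nat := (d U + (#|B| - #|U|))%N.
have [U UF Umax] : exists2 U : {set B}, U \subset ~: tT s0 &
    forall W : {set B}, W \subset ~: tT s0 -> (exc W <= exc U)%N.
  case: (@arg_maxnP _ set0 (fun U => U \subset ~: tT s0) exc); first exact: sub0set.
  by move=> U UF Umax; exists U.
have Ud : (#|U| <= d U)%N.
  have := Umax _ (sub0set _); rewrite /exc d0 cards0 subn0 add0n.
  by have cU : (#|U| <= #|B|)%N := max_card _; lia.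
have dUr : (d U <= r)%N by rewrite -dL dimvS // capvSl.
(* [s2] is a source of values: it has compatible vertices in all blocks of [U] and satisfies the
   equations of [s1]. *)
have [|s2 [v2 e12 c2 U2]] := touch_set (X := U) v1.
  by apply: leq_trans card1; rewrite leq_add2l (leq_trans Ud).
have e02 := ext_trans e01 e12.
pose L1 := (L :\: bsp U)%VS.
have L1L : (L1 <= L)%VS by exact: diffvSl.
have LE : (L = L1 + L :&: bsp U)%VS by rewrite addv_diff_cap.
have L1U : (L1 :&: bsp U = 0)%VS by exact: capv_diff.
have dL1 : (\dim L1 + d U = r)%N.
  rewrite -dL [in RHS]LE dimv_disjoint_sum //; apply/eqP; rewrite -subv0 -L1U.
  by rewrite capvS // capvSr.
(* Hall's condition for [L1]: together with [d U] the dimension is at most [d (U :|: W)], and the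
   excess of [U :|: W] does not exceed that of [U]. *)
have [W WF|X [p1 [XF cX det1]]] := rado j0 (F := ~: tT s0 :\: U) (L := L1).
  have UW : [disjoint U & W].
    rewrite disjoint_sym; apply: disjointWl WF _; rewrite -setI_eq0.
    by apply/eqP/setP => c; rewrite !inE; case: (c \in U); rewrite ?andbF.
  have cUW : #|U :|: W| = (#|U| + #|W|)%N by apply/eqP; rewrite (leq_card_setU U W).2.
  have UWF : U :|: W \subset ~: tT s0 by rewrite subUset UF (subset_trans WF) // subsetDl.
  have := Umax _ UWF; rewrite /exc cUW.
  have : (#|U :|: W| <= #|B|)%N := max_card _; rewrite cUW.
  suff : (\dim (L1 :&: bsp (~: (~: tT s0 :\: U) :|: W)) + d U <= d (U :|: W))%N.
    by move=> h h1 h2; rewrite -(leq_add2r (d U)); apply: leq_trans h _; apply: leq_sub_exchange h1 h2.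
  rewrite -dimv_disjoint_sum; last first.
    by apply/eqP; rewrite -subv0 -L1U capvS ?capvSl ?capvSr.
  apply: dimvS; rewrite subv_add; apply/andP; split; last first.
    by rewrite capvS // bspS // subsetUl.
  apply/subvP => f; rewrite memv_cap => /andP[fL1 /bspP fW].
  have fL := subvP L1L _ fL1; rewrite memv_cap fL /=.
  have /bspP fT := subvP LT _ fL.
  apply/bspP => b j bUW; have [bT|bT] := boolP (b \in tT s0); first by rewrite fT // inE bT.
  apply: fW; move: bUW; rewrite !inE (negPf bT) andbT negbK !negb_or.
  by case/andP=> -> ->.
have UXr : (#|U| + #|X| <= r)%N by rewrite -dL1 addnC leq_add ?cX.
have UXd : [disjoint U & X].
  rewrite disjoint_sym; apply: disjointWl XF _; rewrite -setI_eq0.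
  by apply/eqP/setP => c; rewrite !inE; case: (c \in U); rewrite ?andbF.
have XT : X \subset ~: tT s0 by rewrite (subset_trans XF) // subsetDl.
have cUX : #|U :|: X| = (#|U| + #|X|)%N by apply/eqP; rewrite (leq_card_setU U X).2.
have UXF : U :|: X \subset ~: tT s0 by rewrite subUset UF.
have XU b : b \in X -> (b \in U) = false by move=> bX; rewrite (disjointFl UXd bX).
have TUX b : b \in tT s0 -> (b \in U :|: X) = false.
  by move=> bT; apply: contraTF bT => /(subsetP UXF); rewrite inE.
pose p b := if b \in U then pv s2 b else p1 b.
pose PU := csp [set i | (i.1 \in U) && (i.2 == pv s2 i.1)].
have PUU : (PU <= bsp U)%VS.
  by apply: cspS; apply/subsetP => i; rewrite !inE => /andP[].
have PUP f : f \in PU -> forall b j, (b \notin U) || (j != pv s2 b) -> f (b, j) = 0.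
  by move=> /cspP H b j bj; apply: H; rewrite inE /= negb_and.
have T0U : tT s0 :|: U \subset tT s2.
  by rewrite subUset U2 andbT; case: e02.
pose p' b := if b \in U :|: X then p b else pv s0 b.
(* The blocks of [tT s0] and [U] keep their values from [s2]; those of [X] get fresh compatible
   vertices. *)
have [||||y [yE oky]] := @ok_extend (tT s0 :|: U) X (pv s2) p' (tx s2).
- by rewrite disjoints_subset setCU subsetI XT /= -disjoints_subset disjoint_sym.
- apply: leq_trans (leq_add (leq_card_setU _ _) (leqnn _)) _.
  rewrite -addnA; apply: leq_trans (leq_add _ UXr) card1.
  by apply: subset_leq_card; case: e01.
- move=> b; rewrite /p' /p => /setUP[bT|bU]; last by rewrite inE bU.
  by rewrite TUX //; case: e02 => _ _ _ ->.
- have [_ _ _ ok2] := v2; move=> b c u w bT cT; apply: ok2; exact: (subsetP T0U).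
have x2M f : f \in tM s0 -> dot f (tx s2) = dot f (tx s0) by case: e02 => _ _ /satP H _; exact: H.
have yU b j : b \in U -> y (b, j) = tx s2 (b, j).
  by move=> bU; apply: yE; rewrite (disjointFr UXd bU).
(* [PU] fixes the pivot bits of [U], so these blocks keep exactly their vertices from [s2]; [L1]
   determines the pivot bits of [X]. *)
pose Lt := (PU + L1)%VS.
have [|||||x' [v' e' x'L x'D]] := @touch_valid s0 (U :|: X) p Lt y (tx s2) v0.
- exact: UXF.
- rewrite subv_add (subv_trans L1L LT) andbT (subv_trans PUU) //; exact: bspS.
- rewrite dimv_disjoint_sum ?dim_csp ?card_pivots ?cUX ?cX //.
  by apply/eqP; rewrite -subv0 -L1U capvC capvS.
- move=> _ /memv_addP[f1 f1U [f2 f2L ->]] H.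
  have f20 : f2 = 0.
    apply: det1 => // b bX; have := H b; rewrite inE bX orbT => /(_ isT).
    by rewrite ffunE /p XU // (PUP _ f1U) ?XU // add0r.
  rewrite f20 addr0 in H *; apply/ffunP => -[b j]; rewrite ffunE.
  have [bU|bU] := boolP (b \in U); last by rewrite (PUP _ f1U) // bU.
  have := H b; rewrite inE bU => /(_ isT); rewrite /p bU => h.
  by have [->//|ja] := eqVneq j (pv s2 b); rewrite (PUP _ f1U) // ja orbT.
- rewrite setUA; apply: ok_off oky => b bTX; apply/offP => j.
  rewrite /p' !ffunE /=; case: ifP => // bUX jb.
  have bT : b \in tT s0 by move: bTX bUX; rewrite !inE; case: (b \in tT s0) => //= ->.
  rewrite yE; last by apply: contraFN bUX => bX; rewrite inE bX orbT.
  by rewrite -[LHS]dot_delta -[RHS]dot_delta x2M // V2.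
exists (touch s0 (U :|: X) p Lt x').
have bUM : (bsp U <= PU + pivoff (U :|: X) p)%VS.
  rewrite /PU /pivoff csp_sum; apply: cspS; apply/subsetP => -[b j].
  by rewrite !inE /= /p => ->; case: eqP.
have NE f : f \in N -> exists m0 k l, [/\ m0 \in tM s0, k \in bsp U, l \in L1 & f = m0 + k + l].
  move=> fN; have : f \in (tM s0 + L)%VS by rewrite ML (subvP (addvSl _ _)).
  case/memv_addP=> m0 m0M [l' + ->]; rewrite LE => /memv_addP[l lL1 [k]].
  by rewrite memv_cap => /andP[_ kU] ->; exists m0, k, l; rewrite [l + k]addrC addrA.
have PUt : (PU <= Lt)%VS by exact: addvSl.
have L1t : (L1 <= Lt)%VS by exact: addvSr.
split=> //.
- by apply: leq_trans (leq_card_setU _ _) _; rewrite leq_add2l cUX.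
- apply/subvP => f /NE[m0 [k [l [m0M kU lL ->]]]] /=.
  rewrite !memvD //.
  + by rewrite -addvA (subvP (addvSl _ _)).
  + apply: (subvP _ _ (subvP bUM _ kU)); rewrite subv_add addvSr andbT.
    by apply: (subv_trans PUt); rewrite (subv_trans (addvSr (tM s0) Lt)) ?addvSl.
  + by rewrite (subvP (addvSl _ _)) // (subvP (addvSr _ _)) // (subvP L1t).
- move=> f fN /=; have <- : dot f (tx s2) = dot f (tx s1).
    by case: e12 => _ _ /satP H _; apply: H; apply: (subvP N1).
  have [m0 [k [l [m0M kU lL ->]]]] := NE f fN; rewrite !dotDl; congr (_ + _ + _).
  + by rewrite x2M //; case: e' => _ _ /satP H _; exact: H.
  + have /memv_addP[f1 f1P [f2 f2P kE]] := subvP bUM _ kU.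
    rewrite kE !dotDl x'L ?(subvP PUt) // x'D //; congr (_ + _).
    apply: eq_bigr => -[b j] _; have [bU|bU] := boolP (b \in U); first by rewrite yU.
    suff -> : f2 (b, j) = 0 by rewrite !mul0r.
    have /ffunP/(_ (b, j)) := kE; rewrite ffunE (bspP _ _ kU) // (PUP _ f1P) ?bU //.
    by rewrite add0r => <-.
  + by rewrite x'L // (subvP L1t).
Qed.

(** * Walks and the trade-off between depth and size *)

Variables (S0 : nat) (dep : nat -> nat).
Hypothesis line_step : forall q, (q < S0)%N ->
  [\/ (exists b c, b != c /\ forall z, fals q z -> ~~ cmp b c (blk z b) (blk z c)),
      (exists i, [/\ (i < q)%N, dep q = dep i & forall z, fals q z -> fals i z])
    | (exists i i' (f : E) (k : K), [/\ (i < q)%N, (i' < q)%N, dep q = (maxn (dep i) (dep i')).+1,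
        (forall z, fals q z -> dot f z = k -> fals i z)
        & (forall z, fals q z -> dot f z <> k -> fals i' z)])].

Definition covers s q := forall z, sat s z -> fals q z.

Lemma sat_tx s : sat s (tx s). Proof. exact/satP. Qed.

Lemma covers_ext s s' q : ext s s' -> covers s q -> covers s' q.
Proof. by move=> e cs z /(ext_sat e)/cs. Qed.

(** The state always forces the current clause to be false. Weakenings are followed for free; a
    resolution step costs one touched block and one unit of depth, the answer to the query selecting
    the premise. *)
Lemma walk bad n q s : (q < S0)%N -> valid s -> covers s q -> (#|tT s| + n < m)%N ->
  \sum_(i <- bad) phi s i < 1 ->
  exists s' q', [/\ valid s', ext s s', (#|tT s'| <= #|tT s| + n)%N,
    [/\ (q' < S0)%N, covers s' q' & (dep q' + n <= dep q)%N]
    & \sum_(i <- bad) phi s' i < 1].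
Proof.
elim/ltn_ind: q n s => q IH [|n] s qS vs cs Tm Phi.
  exists s, q; split=> //; last by split=> //; rewrite addn0.
    exact: ext_refl.
  by rewrite addn0.
case: (line_step qS) => [[b [c [bc ax]]]|[i [iq -> H]]|[i [i' [f [k [iq i'q -> H1 H2]]]]]].
(* At least one step remains, so the strict bound leaves room to touch both blocks of the axiom;
   their vertices are then compatible, a contradiction. *)
- exfalso; have [|s1 [v1 e1 c1 b1]] := touch_block b vs; first by lia.
  have [|s2 [v2 e2 c2 b2]] := touch_block c v1; first by lia.
  have e02 := ext_trans e1 e2; have [T12 _ _ _] := e2; have [_ _ _ ok2] := v2.
  have := ax _ (covers_ext e02 cs (sat_tx s2)); rewrite ok2 ?off_refl //.
  exact: (subsetP T12).
- have [|s' [q' [v' e' c' [q'S cs' d'] P']]] := IH i iq n.+1 s (ltn_trans iq qS) vs _ Tm Phi.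
    by move=> z /cs/H.
  by exists s', q'; split.
- have [|s1 [v1 e1 c1 fM1 P1]] := query f vs _ Phi; first by lia.
  have fk z : sat s1 z -> dot f z = dot f (tx s1) by move=> /satP; apply.
  have [i1 [i1q cs1 d1]] : exists i1, [/\ (i1 < q)%N, covers s1 i1
      & (dep i1 <= maxn (dep i) (dep i'))%N].
    have [fk1|/eqP fk1] := eqVneq (dot f (tx s1)) k; [exists i|exists i'].
      by split=> //; [move=> z sz; apply: H1; rewrite ?fk //; apply: cs; exact: ext_sat sz|exact: leq_maxl].
    by split=> //; [move=> z sz; apply: H2; rewrite ?fk //; apply: cs; exact: ext_sat sz|exact: leq_maxr].
  have [|s' [q' [v' e' c' [q'S cs' d'] P']]] := IH i1 i1q n s1 (ltn_trans i1q qS) v1 cs1 _ P1.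
    by lia.
  exists s', q'; split=> //; [exact: ext_trans e'|lia|split=> //; lia].
Qed.

(** The clauses of rank at least [R] have total potential below 1, whereas a clause forced false has
    potential 1. So the walk ends in a clause of rank below [R], and [settle] reduces the newly
    touched blocks to at most [R]. *)
Lemma phase n R q s : (q < S0)%N -> valid s -> covers s q -> (#|tT s| + n + R < m)%N ->
  S0%:R * (2%:R / 3%:R) ^+ R < 1 :> rat ->
  exists s' q', [/\ valid s', (#|tT s'| <= #|tT s| + R)%N, (q' < S0)%N, covers s' q'
    & (dep q' + n <= dep q)%N].
Proof.
move=> qS vs cs Tm SR.
pose bad := [seq i <- iota 0 S0 | (R <= rank s i)%N].
have phi_ge0 s' i : 0 <= phi s' i.
  by rewrite /phi; case: ifP => // _; rewrite exprn_ge0 // divr_ge0.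
have Phi : \sum_(i <- bad) phi s i < 1.
  apply: le_lt_trans SR; rewrite big_filter.
  apply: (@le_trans _ _ (\sum_(i <- iota 0 S0) (2%:R / 3%:R) ^+ R)); last first.
    by rewrite big_const_seq count_predT size_iota iter_addr_0 [leRHS]mulr_natl.
  rewrite big_mkcond; apply: ler_sum => i _; case: ifP => [Ri|_]; last first.
    by rewrite exprn_ge0 // divr_ge0.
  rewrite /phi; case: ifP => _; last by rewrite exprn_ge0 // divr_ge0.
  by apply: ler_wiXn2l; [lra|lra|exact: Ri].
have [|s1 [q1 [v1 e1 c1 [q1S cs1 d1] P1]]] := walk (n := n) qS vs cs _ Phi; first by lia.
have sub1 := fals_sub cs1.
have rk1 : (rank s q1 < R)%N.
  rewrite ltnNge; apply/negP => Rq1.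
  have : phi s1 q1 = 1.
    rewrite /phi /rank (addv_idPr sub1) subnn expr0.
    case: ifPn => // /existsPn/(_ (tx s1)).
    by rewrite sat_tx cs1 ?sat_tx.
  have : phi s1 q1 <= \sum_(i <- bad) phi s1 i.
    rewrite (big_rem q1) /= ?lerDl ?sumr_ge0 //.
    by rewrite mem_filter Rq1 mem_iota.
  by move=> h1 h2; move: P1; rewrite ltNge -h2 h1.
have [|s2 [v2 e2 c2 N2 x2]] := settle vs v1 e1 sub1.
  by apply: leq_trans (leq_add c1 (ltnW rk1)) _; exact: ltnW.
exists s2, q1; split=> //; first by apply: leq_trans c2 _; rewrite leq_add2l; exact: ltnW.
move=> z /satP sz; apply: (fals_of_forms (z := tx s1)); first by apply: cs1; exact: sat_tx.
by move=> f fq; rewrite sz ?x2 // (subvP N2).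
Qed.

Lemma valid0 : valid (State set0 (fun=> j0) 0%VS 0).
Proof.
split=> /=; rewrite ?cap0v // ?dimv0 ?setC0 ?cardsT //.
  by move=> b j; rewrite inE.
by move=> b c u w; rewrite inE.
Qed.

Lemma depth_ge q n : (q < S0)%N -> (forall z, fals q z) -> (n < m)%N -> (n <= dep q)%N.
Proof.
move=> qS fq nm.
have [|||s [q' [_ _ _ [_ _ h] _]]] := @walk [::] n q _ qS valid0.
- by move=> z _.
- by rewrite cards0.
- by rewrite big_nil.
- by apply: leq_trans h; rewrite leq_addl.
Qed.

(** Each of [t] phases descends by [n] and leaves at most [R] more touched blocks; the [n] blocks of
    a walk are reused by the next one. *)
Lemma depth_size_tradeoff q n t R : (q < S0)%N -> (forall z, fals q z) ->
  S0%:R * (2%:R / 3%:R) ^+ R < 1 :> rat -> (t * R + n < m)%N -> (t * n <= dep q)%N.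
Proof.
move=> qS fq SR.
suff H s i : (i < S0)%N -> valid s -> covers s i -> (#|tT s| + t * R + n < m)%N ->
    (t * n <= dep i)%N.
  by move=> Tm; apply: (H _ q qS valid0); rewrite ?cards0.
elim: t s i => [|t IH] s i iS vs cs Tm; first by [].
have [|s' [i' [v' c' i'S cs' d']]] := phase iS vs cs _ SR (n := n); first by lia.
have := IH s' i' i'S v' cs'; lia.
Qed.

End Core.

(** * The binary clique formula *)

Section Bits.
Import mathcomp.boot.fintype mathcomp.boot.finset.
Local Open Scope nat_scope.

Lemma eq_bits l v w : v < 2 ^ l -> w < 2 ^ l ->
  (forall a, a < l -> odd (v %/ 2 ^ a) = odd (w %/ 2 ^ a)) -> v = w.
Proof.
elim: l v w => [|l IH] v w; first by rewrite expn0 !ltnS !leqn0 => /eqP-> /eqP->.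
move=> vl wl bits; have := bits 0 isT; rewrite expn0 !divn1 => odd_vw.
rewrite -(odd_double_half v) -(odd_double_half w) odd_vw; congr (_ + _.*2).
rewrite -!divn2; apply: IH; rewrite ?ltn_divLR // -?expnSr // => a al.
by have := bits a.+1 al; rewrite expnS !divnMA.
Qed.

Lemma all_bits_odd l v : v < 2 ^ l -> (forall a, a < l -> odd (v %/ 2 ^ a)) -> v = (2 ^ l).-1.
Proof.
elim: l v => [|l IH] v; first by rewrite expn0 ltnS leqn0 => /eqP->.
move=> vl bits; have := bits 0 isT; rewrite expn0 divn1 => odd_v.
have vE := odd_double_half v; rewrite odd_v in vE.
have /IH h : v./2 < 2 ^ l by rewrite -divn2 ltn_divLR // -expnSr.
have {}h := h _; rewrite -vE h ?expnS.
  have e0 : 0 < 2 ^ l by rewrite expn_gt0.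
  lia.
by move=> a al; have := bits a.+1 al; rewrite -divn2 expnS divnMA.
Qed.

Lemma ex_num l : exists num : {ffun 'I_l -> bool} -> 'I_(2 ^ l),
  injective num /\ forall u (a : 'I_l), odd (num u %/ 2 ^ a) = u a.
Proof.
pose bits (v : 'I_(2 ^ l)) : {ffun 'I_l -> bool} := [ffun a => odd (v %/ 2 ^ val a)].
have bits_inj : injective bits.
  move=> v w /ffunP vw; apply/val_inj/(eq_bits (ltn_ord v) (ltn_ord w)) => a al.
  by have := vw (Ordinal al); rewrite !ffunE.
have [|num numK bitsK] := inj_card_bij bits_inj.
  by rewrite card_ffun card_bool !card_ord.
exists num; split; first exact: can_inj bitsK.
by move=> u a; have /ffunP/(_ a) := bitsK u; rewrite ffunE.
Qed.

End Bits.

Section Refutation.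
Import mathcomp.boot.fintype mathcomp.boot.finset.
Variables (n kk l Dl m : nat) (j0 : 'I_l).
Hypothesis nE : n = (2 ^ l)%N.
Let N := (kk * n)%N.
Hypothesis NE : N = (2 ^ nbits N)%N.
Variable omega : {set 'I_N * 'I_N}.
Let adj := adj_of omega.
Hypothesis deg : forall (b : 'I_kk) (v : 'I_N), (v %/ n)%N != b ->
  (#|[set u : 'I_N | ((u %/ n)%N == b) && ~~ adj u v]| <= Dl)%N.
Hypothesis m_small : (16 * (m * Dl) <= n)%N.
Variable P : seq (pline (BVar N kk)).
Hypothesis refP : refutation (BinClique adj) P.

Local Notation E := {ffun ('I_kk * 'I_l) -> bool^o}.
Local Notation V := {ffun 'I_l -> bool}.
Variable num : V -> 'I_(2 ^ l).
Hypothesis num_inj : injective num.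
Hypothesis num_bit : forall u (a : 'I_l), odd (num u %/ 2 ^ a)%N = u a.

Lemma n_gt0 : (0 < n)%N. Proof. by rewrite nE expn_gt0. Qed.

Lemma vert_subproof (b : 'I_kk) (u : V) : (b * n + num u < N)%N.
Proof.
have : (num u < n)%N by rewrite [ltnRHS]nE.
have : (b.+1 * n <= kk * n)%N by rewrite leq_mul2r ltn_ord orbT.
rewrite mulSn /N; lia.
Qed.
Definition vert b u : 'I_N := Ordinal (vert_subproof b u).

Lemma vert_block b u : (vert b u %/ n)%N = b.
Proof. by rewrite /= divnMDl ?n_gt0 // divn_small ?addn0 // [ltnRHS]nE. Qed.

Lemma vert_inj b : injective (vert b).
Proof. by move=> u w /(f_equal val) /= /addnI /val_inj /num_inj. Qed.

Definition cmp (b c : 'I_kk) (u w : V) := adj (vert b u) (vert c w).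

Lemma cmpC b c u w : cmp b c u w = cmp c b w u.
Proof. by rewrite /cmp /adj /adj_of orbC. Qed.

Lemma cmp_deg b c w : b != c -> (#|[set u | ~~ cmp b c u w]| <= Dl)%N.
Proof.
move=> bc; have h : (vert c w %/ n)%N != b by rewrite vert_block eq_sym.
apply: leq_trans (deg h); rewrite -(card_imset _ (@vert_inj b)).
apply: subset_leq_card; apply/subsetP => _ /imsetP[u + ->].
by rewrite !inE vert_block eqxx.
Qed.

(** For a bit index [v.2 >= l] no coordinate matches: the form is zero and [bit_const] supplies the
    value. *)
Definition bit_form (v : BVar N kk) : E := [ffun i => (i.1 == v.1) && (val i.2 == val v.2)].
Definition bit_const (v : BVar N kk) : bool := (l <= v.2)%N && odd (v.1 * n %/ 2 ^ v.2)%N.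
(* The low bits of the vertex of block [b] are those of [x], its high bits are
   the binary representation of [b]. *)
Definition assign (x : E) (v : BVar N kk) : bool := dot (bit_form v) x + bit_const v.

Lemma assignE x b (a : 'I_(nbits N)) : assign x (b, a) = vbit (vert b (blk x b)) a.
Proof.
rewrite /assign /bit_const /vbit /=.
have [al|al] := ltnP a l.
  rewrite addr0 /dot (bigD1 (b, Ordinal al)) //= big1 => [|[c j]]; last first.
    rewrite ffunE xpair_eqE /= negb_and.
    by case: (c == b) => //= ja; rewrite -[_ == _]/(j == Ordinal al) (negPf ja).
  rewrite ffunE /= !eqxx addr0.
  (* For [a < l] the summand [b * n] is an even multiple of [2 ^ a] and does not affect bit [a]. *)
  have -> : (b * n = b * 2 ^ (l - a).-1 * 2 * 2 ^ a)%N.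
    by rewrite -!mulnA -expnS -expnD nE; congr (_ * 2 ^ _)%N; lia.
  rewrite divnMDl ?expn_gt0 // oddD !oddM andbF /=.
  by rewrite (num_bit _ (Ordinal al)) ffunE.
rewrite /dot big1 => [|[c j] _]; last first.
  rewrite ffunE /=; case: eqP => //= _; case: eqP => // ja.
  by have := ltn_ord j; rewrite ja ltnNge al.
rewrite add0r; congr odd; have -> : (2 ^ a = n * 2 ^ (a - l))%N.
  by rewrite nE -expnD subnKC.
rewrite !divnMA; congr (_ %/ _)%N.
by rewrite mulnK ?n_gt0 // divnMDl ?n_gt0 // divn_small ?addn0 // [ltnRHS]nE.
Qed.

Definition low_form (f : lform (BVar N kk)) : E := \sum_(v in f) bit_form v.
Definition low_const (f : lform (BVar N kk)) : bool := \sum_(v in f) bit_const v.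

Lemma eval_low x f : eval_form (assign x) f = dot (low_form f) x + low_const f.
Proof. by rewrite /low_form /low_const dot_suml -big_split. Qed.

Definition clause q : lclause (BVar N kk) := (nth (dflt_line _) P q).1.
(** A falsified equation takes the opposite value; the constant from the high bits moves to the
    right-hand side. *)
Definition lines q : seq (E * bool) :=
  [seq (low_form e.1, ~~ e.2 + low_const e.1) | e <- enum (clause q)].

Lemma falsE q x : fals lines q x = ~~ sat_clause (assign x) (clause q).
Proof.
rewrite /fals /lines all_map /sat_clause negb_exists.
apply/allP/forallP => [H e|H e]; last first.
  rewrite mem_enum => eC; have := H e; rewrite eC /= /eval_eq eval_low.
  by case: (dot _ _) (low_const _) e.2 => [] [] [].
apply/negP => /andP[eC]; have := H e; rewrite mem_enum eC => /(_ isT) /=.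
rewrite /eval_eq eval_low.
by case: (dot _ _) (low_const _) e.2 => [] [] [].
Qed.

Definition dep q := ldepth P q.+1 q.

(** Justifications point to earlier lines, so any fuel above the index is enough. *)
Lemma ldepth_fuel q i i' : (q < size P)%N -> (q < i)%N -> (q < i')%N ->
  ldepth P i q = ldepth P i' q.
Proof.
have [_ val_ _] := refP.
elim/ltn_ind: q i i' => q IH [|i] [|i'] // qP qi qi' /=.
have := val_ q qP; rewrite /valid_line; case: (nth _ _ _).2 => [|j k|j] //.
  case=> jq kq _; congr (maxn _ _).+1.
    by apply: IH => //; lia.
  by apply: IH => //; lia.
case=> jq _.
by apply: IH => //; lia.
Qed.

Lemma neq_lits_unsat x (b : 'I_kk) (v : 'I_N) (C : lclause (BVar N kk)) :
  neq_lits b v \subset C -> ~~ sat_clause (assign x) C -> vert b (blk x b) = v.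
Proof.
move=> /subsetP sub; rewrite negb_exists => /forallP uns.
apply/val_inj/(@eq_bits (nbits N)) => [||a al]; [exact: leq_trans (ltn_ord _) (eq_leq NE)|exact: leq_trans (ltn_ord _) (eq_leq NE)|].
have := uns ([set ((b, Ordinal al) : BVar N kk)], ~~ vbit v (Ordinal al)).
rewrite sub ?imset_f //= /eval_eq /eval_form big_set1 assignE /=.
by rewrite /vbit /=; case: odd; case: odd.
Qed.

Lemma line_step q : (q < size P)%N ->
  [\/ (exists b c, b != c /\ forall z, fals lines q z -> ~~ cmp b c (blk z b) (blk z c)),
      (exists i, [/\ (i < q)%N, dep q = dep i & forall z, fals lines q z -> fals lines i z])
    | (exists i i' (f : E) (k : bool), [/\ (i < q)%N, (i' < q)%N,
        dep q = (maxn (dep i) (dep i')).+1,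
        (forall z, fals lines q z -> dot f z = k -> fals lines i z)
        & (forall z, fals lines q z -> dot f z <> k -> fals lines i' z)])].
Proof.
move=> qP; have [_ val_ _] := refP; have := val_ q qP.
rewrite /valid_line -/(clause q); case jE: (nth _ _ q).2 => [|i i'|i].
- case=> [[b [c [v [w [bc vw nadj Ceq]]]]]|[v [b [c [bc Ceq]]]]]; constructor 1; exists b, c; split=> // z.
    rewrite falsE => uns; rewrite /cmp.
    have -> : vert b (blk z b) = v by apply: neq_lits_unsat uns; rewrite Ceq subsetUl.
    by have -> : vert c (blk z c) = w by apply: neq_lits_unsat uns; rewrite Ceq subsetUr.
  (* Falsifying an axiom of the second kind would put one vertex into two blocks. *)
  rewrite falsE => uns; case/negP: bc; apply/eqP/val_inj.
  transitivity (vert b (blk z b) %/ n)%N; first by rewrite vert_block.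
  transitivity (vert c (blk z c) %/ n)%N; last by rewrite vert_block.
  have -> : vert b (blk z b) = v by apply: neq_lits_unsat uns; rewrite Ceq subsetUl.
  by have -> : vert c (blk z c) = v by apply: neq_lits_unsat uns; rewrite Ceq subsetUr.
- case=> iq i'q [f [C [D [C1 C2 Rc]]]]; constructor 3.
  (* [low_form f] takes the value [low_const f] exactly when [f] evaluates to 0, which falsifies
     [f = 1] in the first premise. *)
  exists i, i', (low_form f), (low_const f); split=> //.
  + have [iP i'P] := (ltn_trans iq qP, ltn_trans i'q qP).
    by rewrite {1}/dep /= jE (ldepth_fuel iP iq (ltnSn i)) (ldepth_fuel i'P i'q (ltnSn i')).
  + move=> z; rewrite !falsE => uns fz; apply: contraNN uns => /existsP[e /andP[]].
    rewrite {1}/clause C1 => /setUP[eC ez|/set1P->].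
      by apply/existsP; exists e; rewrite ez Rc inE eC.
    by rewrite /eval_eq eval_low fz /=; case: (low_const f).
  + move=> z; rewrite !falsE => uns fz; apply: contraNN uns => /existsP[e /andP[]].
    rewrite {1}/clause C2 => /setUP[eC ez|/set1P->].
      by apply/existsP; exists e; rewrite ez Rc inE eC orbT.
    by rewrite /eval_eq eval_low /=; case: (dot _ _) (low_const f) fz => [] [].
- case=> iq w; constructor 2; exists i; split=> //.
    by rewrite {1}/dep /= jE (ldepth_fuel (ltn_trans iq qP) iq (ltnSn i)).
  by move=> z; rewrite !falsE; apply: contraNN; apply: w.
Qed.

Lemma refutation_size_gt0 : (0 < size P)%N. Proof. by case: refP. Qed.

Lemma last_fals z : fals lines (size P).-1 z.
Proof.
rewrite falsE; have [_ _ E0] := refP; rewrite /clause E0.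
by apply/existsPn => e; rewrite inE.
Qed.

Lemma proof_depthE : proof_depth P = dep (size P).-1.
Proof. by rewrite /dep prednK ?refutation_size_gt0. Qed.

Lemma card_l : (16 * (m * Dl) <= 2 ^ #|{: 'I_l}|)%N.
Proof. by rewrite card_ord -nE. Qed.

Lemma refutation_depth q : (q < m)%N -> (q <= proof_depth P)%N.
Proof.
have last_lt : ((size P).-1 < size P)%N by rewrite prednK ?refutation_size_gt0.
rewrite proof_depthE => qm.
exact: (depth_ge j0 card_bool cmpC cmp_deg card_l line_step last_lt last_fals qm).
Qed.

Lemma refutation_tradeoff t q r : (size P)%:R * (2%:R / 3%:R) ^+ r < 1 :> rat ->
  (t * r + q < m)%N -> (t * q <= proof_depth P)%N.
Proof.
have last_lt : ((size P).-1 < size P)%N by rewrite prednK ?refutation_size_gt0.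
rewrite proof_depthE => h qm.
exact: (depth_size_tradeoff j0 card_bool cmpC cmp_deg card_l line_step last_lt last_fals h qm).
Qed.

End Refutation.

(** * Soundness and trivial refutations *)

Section NoRefutation.
Import mathcomp.boot.fintype mathcomp.boot.finset.

Lemma soundness (V : finType) (F : lclause V -> Prop) (P : seq (pline V)) (alpha : V -> bool) :
  (forall C, F C -> sat_clause alpha C) -> ~ refutation F P.
Proof.
move=> Fsat [P0 valid_ last0].
have H q : (q < size P)%N -> sat_clause alpha (nth (dflt_line V) P q).1.
  elim/ltn_ind: q => q IH qP; have := valid_ q qP; rewrite /valid_line.
  case: (nth _ _ q).2 => [/Fsat //|i j|i]; last first.
    by case=> iq; apply; apply: IH => //; exact: ltn_trans qP.
  case=> iq jq [f [C [D [C1 C2 ->]]]].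
  have := IH i iq (ltn_trans iq qP); have := IH j jq (ltn_trans jq qP).
  rewrite C1 C2 => /existsP[e /andP[/setUP[eD ez|/set1P->]]].
    by move=> _; apply/existsP; exists e; rewrite ez inE eD orbT.
  move=> f0 /existsP[e' /andP[/setUP[eC ez|/set1P->]]].
    by apply/existsP; exists e'; rewrite ez inE eC.
  by move: f0; rewrite /eval_eq /= => /eqP->.
have := H (size P).-1; rewrite prednK // => /(_ (leqnn _)).
by rewrite last0 => /existsP[e]; rewrite inE.
Qed.

(* If [N] is not a power of two, the all-ones string encodes no vertex, and
   giving it to all variables satisfies the formula. *)
Lemma no_refutation (N kk : nat) (adj : rel 'I_N) (P : seq (pline (BVar N kk))) :
  N != (2 ^ nbits N)%N -> ~ refutation (BinClique adj) P.
Proof.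
move=> NE; apply: (@soundness _ _ _ (fun=> true)) => C.
have lt_N : (N < 2 ^ nbits N)%N by rewrite ltn_neqAle NE up_logP.
have sat_lits (i : 'I_kk) (v : 'I_N) : neq_lits i v \subset C -> sat_clause (fun=> true) C.
  move=> /subsetP sub.
  have /existsP[a va] : [exists a : 'I_(nbits N), ~~ vbit v a].
    apply: contraT; rewrite negb_exists => /forallP H.
    have vE : nat_of_ord v = (2 ^ nbits N).-1.
      apply: all_bits_odd => [|a al]; first exact: ltn_trans lt_N.
      by have := H (Ordinal al); rewrite negbK.
    by have := ltn_ord v; rewrite vE; lia.
  apply/existsP; exists ([set ((i, a) : BVar N kk)], ~~ vbit v a).
  by rewrite sub ?imset_f // /eval_eq /eval_form big_set1 va.
case=> [[i [j [v [w [_ _ _ CE]]]]]|[v [i [j [_ CE]]]]];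
  by apply: (sat_lits i v); rewrite CE subsetUl.
Qed.

(** A single line has no earlier line to resolve. This makes the logarithm of the size positive. *)
Lemma depth_size (V : finType) (F : lclause V -> Prop) (P : seq (pline V)) :
  refutation F P -> (0 < proof_depth P)%N -> (1 < size P)%N.
Proof.
case=> P0 valid_ _; case s1: (size P) P0 => [|[|s]] // _.
rewrite /proof_depth s1 /=; have := valid_ 0%N; rewrite s1 /valid_line => /(_ isT).
by case: (nth _ _ _).2 => // i j [].
Qed.

End NoRefutation.

(** * Random multipartite graphs *)

Section RandomGraph.
Import mathcomp.boot.fintype mathcomp.boot.finset.
Variable R : realType.

(** Independence: for a random subset [w] of [C], the expectation of a product over the missed
    elements factors. [bigA_distr] expands the product over all sets, those not inside [C]
    contributing 0. *)
Lemma sum_powerset_prod (I : finType) (C : {set I}) (p : R) (c : I -> R) :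
  \sum_(w in powerset C) p ^+ #|w| * (1 - p) ^+ (#|C| - #|w|) * \prod_(e in C :\: w) c e =
  \prod_(e in C) (p + (1 - p) * c e).
Proof.
have -> : \prod_(e in C) (p + (1 - p) * c e) =
    \prod_e ((if e \in C then p else 0) + (if e \in C then (1 - p) * c e else 1)).
  by rewrite big_mkcond; apply: eq_bigr => e _; case: ifP; rewrite ?add0r.
rewrite bigA_distr big_mkcond; apply: eq_bigr => w _; rewrite powersetE.
case: ifPn => [wC|]; last first.
  by case/subsetPn => e ew eC; rewrite (bigD1 e) //= ew (negPf eC) mul0r.
have -> : (#|C| - #|w|)%N = #|C :\: w|.
  by rewrite cardsD (setIidPr wC).
rewrite -mulrA -!prodr_const -big_split /= big_mkcond [X in _ * X]big_mkcond -big_split /=.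
apply: eq_bigr => e _; rewrite inE; have [ew|ew] := boolP (e \in w).
  by rewrite (subsetP wC) // mulr1.
by rewrite mul1r.
Qed.

Variables (n kk : nat) (p : R).
Hypothesis p01 : 0 <= p <= 1.
Hypothesis n0 : (0 < n)%N.
Let N := (kk * n)%N.
Local Notation C := (cross_pairs n kk).
Let wt (w : {set 'I_N * 'I_N}) : R := p ^+ #|w| * (1 - p) ^+ (#|C| - #|w|).

Lemma wt_ge0 w : 0 <= wt w.
Proof. by case/andP: p01 => p0 p1; rewrite mulr_ge0 // exprn_ge0 // subr_ge0. Qed.

Lemma wt_total : \sum_(w in powerset C) wt w = 1.
Proof.
have h : \prod_(e in C) (p + (1 - p) * 1) = 1 by apply: big1 => e _; ring.
rewrite -[RHS]h -sum_powerset_prod; apply: eq_bigr => w _.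
by rewrite big1 ?mulr1.
Qed.

(* Exponential Markov inequality for [4 ^ #|S :\: w|]. *)
Lemma wt_tail (S : {set 'I_N * 'I_N}) (D : nat) : S \subset C ->
  \sum_(w in powerset C | (D < #|S :\: w|)%N) wt w <= (1 + 3%:R * (1 - p)) ^+ #|S| / 4%:R ^+ D.
Proof.
move=> SC; rewrite ler_pdivlMr ?exprn_gt0 //.
pose c e : R := if e \in S then 4%:R else 1.
have -> : (1 + 3%:R * (1 - p)) ^+ #|S| = \prod_(e in C) (p + (1 - p) * c e).
  have e2 : \prod_(e in C :\: S) (p + (1 - p) * c e) = 1.
    by apply: big1 => e; rewrite inE /c => /andP[/negPf-> _]; ring.
  rewrite -prodr_const [RHS](big_setID S) /= (setIidPr SC) e2 mulr1.
  by apply: eq_bigr => e eS; rewrite /c eS; ring.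
rewrite -sum_powerset_prod mulr_suml big_mkcondr; apply: ler_sum => w wC.
have cE : \prod_(e in C :\: w) c e = 4%:R ^+ #|S :\: w|.
  have e2 : \prod_(e in C :\: w :\: S) c e = 1.
    by apply: big1 => e; rewrite inE /c => /andP[/negPf-> _].
  rewrite -prodr_const [LHS](big_setID S) /= e2 mulr1.
  have -> : (C :\: w) :&: S = S :\: w by rewrite setIDAC (setIidPr SC).
  by apply: eq_bigr => e; rewrite inE /c => /andP[_ ->].
rewrite cE; case: ifP => [DS|_]; last by rewrite mulr_ge0 ?wt_ge0 ?exprn_ge0.
by rewrite ler_wpM2l ?wt_ge0 // ler_weXn2l ?ler1n // ltnW.
Qed.

Definition few_nonadj (D : nat) (w : {set 'I_N * 'I_N}) :=
  [forall b : 'I_kk, forall v : 'I_N, ((v %/ n)%N != b) ==>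
     (#|[set u : 'I_N | ((u %/ n)%N == b) && ~~ adj_of w u v]| <= D)%N].

Definition edge (v u : 'I_N) : 'I_N * 'I_N := if (v < u)%N then (v, u) else (u, v).
Definition star (b : 'I_kk) (v : 'I_N) := [set edge v u | u in [set u : 'I_N | (u %/ n)%N == b]].

Lemma edge_inj v : injective (edge v).
Proof.
move=> u u'; rewrite /edge; case: ltnP => vu; case: ltnP => vu' [] // h1 h2.
  by rewrite h2 ltnn in vu.
by rewrite h2 ltnn in vu'.
Qed.

Lemma star_sub (b : 'I_kk) (v : 'I_N) : (v %/ n)%N != b -> star b v \subset C.
Proof.
move=> vb; apply/subsetP => _ /imsetP[u + ->]; rewrite inE => /eqP ub.
rewrite inE /edge; have [vu|vu] := boolP (v < u)%N; rewrite /= ub; first by rewrite vu.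
rewrite -leqNgt in vu; rewrite eq_sym vb andbT ltn_neqAle vu andbT.
by apply: contraNneq vb => <-; rewrite ub.
Qed.

Lemma card_star b v : (#|star b v| <= n)%N.
Proof.
apply: leq_trans (leq_imset_card _ _) _.
pose h (u : 'I_N) : 'I_n := Ordinal (ltn_pmod u n0).
rewrite -[leqRHS]card_ord -(card_in_imset (f := h)); first exact: max_card.
move=> u u'; rewrite !inE => /eqP ub /eqP ub' [h_eq]; apply: val_inj.
by rewrite /= (divn_eq u n) (divn_eq u' n) ub ub' h_eq.
Qed.

Lemma nonadj_star (b : 'I_kk) (v : 'I_N) (w : {set 'I_N * 'I_N}) : (#|[set u : 'I_N | ((u %/ n)%N == b) && ~~ adj_of w u v]| <= #|star b v :\: w|)%N.
Proof.
rewrite -(card_imset _ (@edge_inj v)); apply: subset_leq_card.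
apply/subsetP => _ /imsetP[u + ->]; rewrite !inE => /andP[ub]; rewrite negb_or => /andP[h1 h2].
apply/andP; split; last by apply/imsetP; exists u; rewrite ?inE.
by rewrite /edge; case: ifP.
Qed.

(** Union bound over pairs of a block and a vertex, with [wt_tail] applied to the at most [n]
    potential edges between them. *)
Lemma wt_few_nonadj D :
  1 - (kk * N)%:R * ((1 + 3%:R * (1 - p)) ^+ n / 4%:R ^+ D) <=
  \sum_(w in powerset C | few_nonadj D w) wt w.
Proof.
rewrite lerBlDr -[leLHS]wt_total (bigID (few_nonadj D)) /= lerD2l.
pose bad (i : 'I_kk * 'I_N) w := ((i.2 %/ n)%N != i.1) && (D < #|star i.1 i.2 :\: w|)%N.
apply: (@le_trans _ _ (\sum_(i : 'I_kk * 'I_N) \sum_(w in powerset C | bad i w) wt w)).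
  rewrite (exchange_big_dep (fun w => w \in powerset C)) /=; last by move=> i w _ /andP[].
  rewrite big_mkcondr; apply: ler_sum => w wC; case: ifPn => [|_]; last first.
    by apply: sumr_ge0 => *; exact: wt_ge0.
  rewrite negb_forall => /existsP[b]; rewrite negb_forall => /existsP[v].
  rewrite negb_imply -ltnNge => /andP[vb Dlt].
  rewrite (bigD1 (b, v)) /=; first by rewrite lerDl sumr_ge0 // => *; exact: wt_ge0.
  by rewrite wC /bad /= vb (leq_trans Dlt) // nonadj_star.
have p1 : 1 <= 1 + 3%:R * (1 - p) by case/andP: p01 => _ ?; rewrite lerDl mulr_ge0 // subr_ge0.
apply: (@le_trans _ _ (\sum_(i : 'I_kk * 'I_N) (1 + 3%:R * (1 - p)) ^+ n / 4%:R ^+ D)).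
  apply: ler_sum => -[b v] _; have [vb|vb] := eqVneq (v %/ n)%N b.
    rewrite big_pred0 => [|w]; first by rewrite divr_ge0 ?exprn_ge0 // (le_trans _ p1).
    by rewrite /bad /= vb eqxx andbF.
  rewrite (eq_bigl (fun w => (w \in powerset C) && (D < #|star b v :\: w|)%N)); last first.
    by move=> w; rewrite /bad /= vb.
  apply: le_trans (wt_tail _ (star_sub vb)) _.
  rewrite ler_pM2r ?invr_gt0 ?exprn_gt0 //.
  by apply: ler_weXn2l => //; exact: card_star.
by rewrite sumr_const card_prod !card_ord [leRHS]mulr_natl.
Qed.

Lemma gnpk_prob_ge (E : {set 'I_N * 'I_N} -> Prop) D :
  (forall w, few_nonadj D w -> E w) ->
  1 - (kk * N)%:R * ((1 + 3%:R * (1 - p)) ^+ n / 4%:R ^+ D) <= gnpk_prob p E.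
Proof.
move=> goodE; apply: le_trans (wt_few_nonadj D) _.
rewrite big_mkcondr; apply: ler_sum => w _; rewrite -/(wt w).
case: ifP => [/goodE Ew|_]; first by rewrite asboolT // mulr1.
by rewrite mulr_ge0 ?wt_ge0 //; case: ifP.
Qed.

Lemma gnpk_prob_le1 (E : {set 'I_N * 'I_N} -> Prop) : gnpk_prob p E <= 1.
Proof.
rewrite -wt_total; apply: ler_sum => w _; rewrite -/(wt w).
by case: ifP => _; rewrite ?mulr1 // mulr0 wt_ge0.
Qed.

End RandomGraph.

(** * Asymptotics *)

Section Asymptotics.
Variable R : realType.

Lemma expR1_le4 : expR 1 <= 4%:R :> R.
Proof.
have h : 2^-1 <= expR (- 2^-1) :> R by apply: le_trans (expR_ge1Dx _); lra.
have -> : 1 = 2^-1 + 2^-1 :> R by lra.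
have e0 : 0 < expR (2^-1) :> R := expR_gt0 _.
have e1 : expR (2^-1) * expR (- 2^-1) = 1 :> R by rewrite -expRD subrr expR0.
rewrite expRD; have e2 : expR (2^-1) <= 2 :> R by nra.
by nra.
Qed.

Lemma ln2_gt0 : 0 < ln 2 :> R.
Proof. by apply: ln_gt0; lra. Qed.

Lemma ln2_le1 : ln 2 <= 1 :> R.
Proof. by have -> : 2 = 1 + 1 :> R by []; apply: le_ln1Dx; lra. Qed.

(** The rank threshold [2 * j] works because [2 * (2/3)^2 = 8/9 < 1]. *)
Lemma two_thirds_exp (F : realFieldType) (S j : nat) : (0 < j)%N -> (S <= 2 ^ j)%N ->
  S%:R * (2%:R / 3%:R) ^+ (2 * j) < 1 :> F.
Proof.
move=> j0 Sj; have k1 : 8%:R / 9%:R < 1 :> F by lra.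
have k0 : 0 <= 8%:R / 9%:R :> F by lra.
have q0 : 0 <= 2%:R / 3%:R :> F by lra.
apply: (@le_lt_trans _ _ ((8%:R / 9%:R) ^+ j)); last by rewrite exprn_ilt1 // -lt0n.
have -> : 8%:R / 9%:R = 2%:R * (2%:R / 3%:R) ^+ 2 :> F by rewrite expr2; field.
have -> : (2%:R / 3%:R) ^+ (2 * j) = ((2%:R / 3%:R) ^+ 2) ^+ j :> F by rewrite exprM.
by rewrite [leRHS]exprMn ler_wpM2r ?exprn_ge0 // -natrX ler_nat.
Qed.

(** Here [u] and [s] are the roots of [m] and [ln S], [j] is the rounded binary logarithm of [S],
    and [l = ln 2]. The hypotheses give [l * u^4 <= 64 * s^2 * D]; one factor [s <= u] is traded for
    [u] and cancelled. *)
Lemma long_walk_arith (F : realFieldType) (D s u j l : F) :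
  0 < l -> 0 < u -> 0 < s -> 0 <= D -> s <= u ->
  (u * u) * (u * u) <= 32 * j * D -> j * l <= 2 * (s * s) ->
  l / 64 * (u * u * u) <= D * s.
Proof.
move=> l0 u0 s0 D0 su h1 h2.
have h3 : l * ((u * u) * (u * u)) <= l * (32 * j * D) by rewrite ler_pM2l.
have h4 : j * l * D <= 2 * (s * s) * D by rewrite ler_wpM2r.
have h5 : D * s * s <= D * s * u by rewrite ler_wpM2l // mulr_ge0 // ltW.
by rewrite -(ler_pM2r u0); lra.
Qed.

(** With the same notation, [j >= m / 8] makes [ln S] of order at least [m], so [D >= m / 2]
    suffices; [l <= 1] avoids a root of [l]. *)
Lemma short_walk_arith (F : realFieldType) (D s u j l : F) :
  0 < l -> l <= 1 -> 0 < u -> 0 < s ->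
  u * u <= 2 * D -> u * u <= 8 * j -> j * l <= 2 * (s * s) ->
  l / 64 * (u * u * u) <= D * s.
Proof.
move=> l0 l1 u0 s0 h1 h2 h3.
have uu : 0 < u * u by rewrite mulr_gt0.
have h4 : u * u * l <= 8 * j * l by rewrite ler_pM2r.
have h5 : u * u * l * l <= u * u * l by rewrite ler_piMr // mulr_ge0 // ltW.
have su : u * (l / 4) <= s.
  rewrite leNgt; apply/negP => lt_s.
  have h6 : s * s < (u * (l / 4)) * (u * (l / 4)) by apply: ltr_pM => //; rewrite ltW.
  lra.
apply: (@le_trans _ _ ((u * u / 2) * (u * (l / 4)))).
  have : 0 <= u * u * u * l by rewrite !mulr_ge0 // ltW.
  lra.
apply: ler_pM => //; [lra| |lra].
by rewrite mulr_ge0 ?divr_ge0 // ltW.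
Qed.

(** Half of the budget [m] pays for the [2 * j] blocks kept after each of [t] phases, the other half
    for one walk of length [q]; the predecessor in [q] makes the total strict. *)
Lemma phase_lengths (m j : nat) (t := (m %/ (4 * j))%N) (q := (m %/ 2).-1) :
  (0 < j)%N -> (16 <= m)%N -> (8 * j <= m)%N ->
  (t * (2 * j) + q < m)%N /\ (m * m <= 32 * j * (t * q))%N.
Proof.
move=> j0 m16 jm; have j4 : (0 < 4 * j)%N by lia.
have h1 := leq_divM m (4 * j); have h2 := leq_divM m 2.
have h3 := divn_eq m 2; have h4 := ltn_pmod m (isT : (0 < 2)%N).
have h5 := divn_eq m (4 * j); have h6 := ltn_pmod m j4.
have t2 : (2 <= t)%N by rewrite leq_divRL //; lia.
have q4 : (m <= 4 * q)%N by rewrite /q; lia.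
have t8 : (m <= 8 * j * t)%N by rewrite /t in t2 *; nia.
split; first by rewrite /t /q in h1 h2 *; lia.
by apply: leq_trans (leq_mul t8 q4) _; rewrite [leqRHS](_ : _ = 8 * j * t * (4 * q))%N //; ring.
Qed.

Lemma depth_sqrt_ln_size (D S m : nat) : (16 <= m)%N -> (1 < S)%N ->
  (forall q, (q < m)%N -> (q <= D)%N) ->
  (forall t q r, S%:R * (2%:R / 3%:R) ^+ r < 1 :> rat ->
     (t * r + q < m)%N -> (t * q <= D)%N) ->
  ln 2 / 64 * (m%:R * Num.sqrt m%:R) <= D%:R * Num.sqrt (ln S%:R) :> R.
Proof.
move=> m16 S1 deep trade.
pose j := up_log 2 S.
have /andP[jl ju] : (2 ^ j.-1 < S <= 2 ^ j)%N by exact: up_log_bounds.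
have j0 : (0 < j)%N by rewrite up_log_gt0.
have l0 := ln2_gt0; have l1 := ln2_le1.
set L := ln S%:R; have L0 : 0 < L by apply: ln_gt0; rewrite ltr1n.
have S0 : 0 < S%:R :> R by rewrite ltr0n ltnW.
have Lj : L <= j%:R.
  apply: (@le_trans _ _ (ln (2 ^ j)%:R)).
    by rewrite ler_ln ?posrE ?ler_nat // ltr0n expn_gt0.
  rewrite natrX lnXn // -[leLHS]mulr_natl; have : 0 <= j%:R :> R by []. nra.
(* Rounding up adds at most 1 to the binary logarithm, which is itself at least 1 since [S >= 2]. *)
have jL : j%:R * ln 2 <= 2 * L.
  have h1 : ln 2 <= L by rewrite ler_ln ?posrE ?ler_nat // ltr0n.
  have h2 : j.-1%:R * ln 2 <= L.
    by rewrite mulr_natl -lnXn // -natrX ler_ln ?posrE ?ler_nat ?(ltnW jl) // ltr0n expn_gt0.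
  have -> : j%:R = j.-1%:R + 1 :> R by rewrite natr1 prednK.
  lra.
set s := Num.sqrt L; set u := Num.sqrt m%:R.
have s2 : s * s = L by rewrite -expr2 sqr_sqrtr // ltW.
have u2 : u * u = m%:R by rewrite -expr2 sqr_sqrtr.
have s0 : 0 < s by rewrite sqrtr_gt0.
have u0 : 0 < u by rewrite sqrtr_gt0 ltr0n; lia.
(* If [8 * j <= m], at least two phases fit into the budget; otherwise the plain depth bound is
   enough. *)
rewrite -u2; have [jm|jm] := leqP (8 * j) m.
  have [tq_lt tq_ge] := phase_lengths j0 m16 jm.
  have tD := trade _ _ _ (two_thirds_exp _ j0 ju) tq_lt.
  have mD : (m * m <= 32 * j * D)%N by apply: leq_trans tq_ge _; rewrite leq_mul2l tD orbT.
  have mDR : m%:R * m%:R <= 32 * j%:R * D%:R :> R by rewrite -!natrM ler_nat.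
  have su : s <= u.
    by rewrite ler_wsqrtr // (le_trans Lj) // ler_nat (leq_trans _ jm) // leq_pmull.
  apply: (long_walk_arith (j := j%:R) l0 u0 s0 (ler0n _ D) su); rewrite ?u2 ?s2 //.
apply: (short_walk_arith l0 l1 u0 s0 (j := j%:R)); rewrite ?s2 ?u2 -?natrM ?ler_nat ?(ltnW jm) //.
by have := deep m.-1; lia.
Qed.

Lemma near_powR_ge (a A : R) : 0 < a -> \forall n \near \oo%classic, A <= n%:R `^ a.
Proof.
move=> a0; have := nbhs_infty_gtr (Num.max A 0 `^ a^-1); apply: filterS => n hn.
have M0 : 0 <= Num.max A 0 by rewrite le_max lexx orbT.
apply: (@le_trans _ _ (Num.max A 0)); first by rewrite le_max lexx.
have -> : Num.max A 0 = (Num.max A 0 `^ a^-1) `^ a.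
  by rewrite -powRrM mulVf ?gt_eqF // powRr1.
apply: ge0_ler_powR; rewrite ?nnegrE ?powR_ge0 ?(ltW a0) ?(ltW hn) //.
Qed.

Lemma cvg_1_harmonic : ((fun n => 1 - 2 * harmonic n : R) @ \oo --> (1 : R))%classic.
Proof.
suff : ((fun n => 1 - 2 * harmonic n : R) @ \oo --> (1 - 2 * 0 : R))%classic.
  by rewrite mulr0 subr0.
apply: cvgB; first exact: cvg_cst.
by apply: cvgM; [exact: cvg_cst|exact: cvg_harmonic].
Qed.

Lemma inv_le_harmonic n : (0 < n)%N -> n%:R^-1 <= 2 * harmonic n :> R.
Proof.
move=> n0; rewrite /harmonic /= -[2]invrK -invfM lef_pV2 ?posrE ?mulr_gt0 ?ltr0n //.
by rewrite ler_pdivrMl // -natrM ler_nat; lia.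
Qed.

(** With the factor 4 and the rounding up, [4 ^ max_nonadj g n] exceeds [exp (4 * n^(1-g))] and
    beats the numerator [exp (3 * n^(1-g))] of the tail bound. *)
Definition max_nonadj (g : R) (n : nat) : nat := (Num.truncn (4 * n%:R `^ (1 - g))).+1.

Lemma refutation_lb_of_few_nonadj (g : R) (n kk : nat) w : 0 < g < 1 ->
  (1 < n)%N -> 2560 <= n%:R `^ g -> @few_nonadj n kk (max_nonadj g n) w ->
  @refutation_lb R n kk w (ln 2 / 64 / 160 / 13 * n%:R `^ (3 * g / 2)).
Proof.
move=> /andP[g0 g1] n1 x_large few P refP.
set N := (kk * n)%N in w few P refP *.
(* If [N] is not a power of two, there is no refutation to bound; otherwise its divisor [n] is a
   power of two, and a block consists of the vertices with given high bits. *)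
have [NE|NE] := eqVneq N (2 ^ nbits N)%N; last by have := no_refutation NE refP.
have [l _ nE] : exists2 l, (l <= nbits N)%N & n = (2 ^ l)%N.
  by apply/dvdn_pfactor => //; rewrite -NE dvdn_mull.
have l0 : (0 < l)%N by case: l nE n1 => // ->.
have [num [num_inj num_bit]] := ex_num l.
set Dl := max_nonadj g n in few.
pose m := (n %/ (16 * Dl))%N.
have m_small : (16 * (m * Dl) <= n)%N by rewrite mulnCA leq_divM.
have deg (b : 'I_kk) (v : 'I_N) : (v %/ n)%N != b ->
    (#|[set u : 'I_N | ((u %/ n)%N == b) && ~~ adj_of w u v]%SET| <= Dl)%N.
  by move=> vb; have /forallP/(_ b)/forallP/(_ v)/implyP/(_ vb) := few.
have deep := refutation_depth (Ordinal l0) nE NE deg m_small refP num_inj num_bit.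
have trade := refutation_tradeoff (Ordinal l0) nE NE deg m_small refP num_inj num_bit.
have n0 : 0 < n%:R :> R by rewrite ltr0n ltnW.
set x := n%:R `^ g in x_large *; set y := n%:R `^ (1 - g).
have xy : x * y = n%:R.
  by rewrite /x /y -powRD ?(gt_eqF n0) ?implybT // addrC subrK powRr1 // ltW.
have y1 : 1 <= y by rewrite -(powRr0 n%:R); apply: ler_powR; rewrite ?ler1n ?(ltnW n1) //; lra.
have DlR : Dl%:R <= 5 * y.
  rewrite /Dl /max_nonadj -natr1 -/y.
  have : (Num.truncn (4 * y))%:R <= 4 * y by rewrite truncn_le; lra.
  lra.
have mx : x <= 80 * (m%:R + 1).
  have lt_n : (n <= m.+1 * (16 * Dl))%N by rewrite ltnW // ltn_ceil //.
  have : n%:R <= m.+1%:R * (16 * Dl%:R) :> R by rewrite -!natrM ler_nat.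
  rewrite -natr1 -xy => h; rewrite -(ler_pM2r (lt_le_trans ltr01 y1)).
  apply: le_trans h _; have : 0 <= m%:R :> R by [].
  nra.
(* The threshold 2560 gives [m >= 16] and absorbs the [+ 1], leaving [x / 160 <= m]; the constant 13
   comes from [160 <= 13^2]. *)
have m16 : (16 <= m)%N by rewrite -(ler_nat R); lra.
have S1 : (1 < size P)%N by apply: depth_size refP _; apply: deep; apply: leq_trans m16.
apply: le_trans (depth_sqrt_ln_size m16 S1 deep trade).
have -> : n%:R `^ (3 * g / 2) = x * Num.sqrt x.
  rewrite -[Num.sqrt x]powR12_sqrt ?powR_ge0 // /x -powRrM -powRD; last first.
    by rewrite (gt_eqF n0) implybT.
  by congr (_ `^ _); lra.
rewrite -!mulrA ler_pM2l ?ln2_gt0 // ler_pM2l ?invr_gt0 //.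
have xm : x / 160 <= m%:R by lra.
have -> : 160^-1 * (13^-1 * (x * Num.sqrt x)) = (x / 160) * (Num.sqrt x / 13) by lra.
apply: ler_pM; [by lra|by apply: divr_ge0; rewrite ?sqrtr_ge0|exact: xm|].
have -> : Num.sqrt x / 13 = Num.sqrt (x / 169).
  rewrite sqrtrM; last by lra.
  congr (_ * _); rewrite -[RHS]ger0_norm ?sqrtr_ge0 // -sqrtr_sqr sqr_sqrtr; last by lra.
  by rewrite -[LHS]ger0_norm ?invr_ge0 // -sqrtr_sqr; congr Num.sqrt; lra.
by apply: ler_wsqrtr; lra.
Qed.

(** With [y = n^(1-g)] and [t = n^a], the root of [y], the tail ratio is at most [exp (- y)]. The
    [kk^2 * n] cases and a spare factor [n] cost at most [exp ((2 + 2 / a) * t) <= exp y], by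
    [a * ln n <= n^a]; so [1 / n] remains. *)
Lemma many_nonadj_prob (g p : R) (n kk : nat) (a : R) : 0 < g < 1 -> a = (1 - g) / 2 ->
  0 <= p <= 1 -> (1 < n)%N -> 1 - n%:R `^ (- g) <= p -> kk%:R <= expR (n%:R `^ a) ->
  2 + 2 / a <= n%:R `^ a ->
  (kk * (kk * n))%:R * ((1 + 3%:R * (1 - p)) ^+ n / 4%:R ^+ max_nonadj g n) <= 2 * harmonic n.
Proof.
move=> /andP[g0 g1] aE /andP[p0 p1] n1 pn kn tn.
have n0 : 0 < n%:R :> R by rewrite ltr0n ltnW.
have a0 : 0 < a by rewrite aE; lra.
set t := n%:R `^ a in kn tn *; set y := n%:R `^ (1 - g).
have yt : y = t * t.
  by rewrite /y /t -powRD ?(gt_eqF n0) ?implybT //; congr (_ `^ _); rewrite aE; field.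
have np : n%:R * (1 - p) <= y.
  have -> : y = n%:R * n%:R `^ (- g).
    by rewrite /y powRD ?(gt_eqF n0) ?implybT // powRr1 // ltW.
  by rewrite ler_pM2l //; lra.
have top : (1 + 3%:R * (1 - p)) ^+ n <= expR (3 * y).
  apply: (@le_trans _ _ (expR (3%:R * (1 - p)) ^+ n)).
    by rewrite lerXn2r ?nnegrE ?expR_ge0 ?expR_ge1Dx //; lra.
  by rewrite -expRM_natl ler_expR; lra.
have bot : expR (4 * y) <= 4%:R ^+ max_nonadj g n.
  apply: (@le_trans _ _ (expR 1 ^+ max_nonadj g n)).
    by rewrite -expRM_natl mulr1 ler_expR ltW // truncnS_gt.
  by rewrite lerXn2r ?nnegrE ?expR_ge0 ?expR1_le4.
have ratio : (1 + 3%:R * (1 - p)) ^+ n / 4%:R ^+ max_nonadj g n <= expR (- y).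
  rewrite ler_pdivrMr ?exprn_gt0 //; apply: le_trans top _.
  have -> : 3 * y = - y + 4 * y by ring.
  by rewrite expRD ler_pM2l ?expR_gt0.
have lnn : a * ln n%:R <= t.
  by rewrite -ln_powR; apply/ltW/ln_sublinear; rewrite powR_gt0.
have nE : n%:R = expR (ln n%:R) :> R by rewrite lnK // posrE.
have kk2 : (kk * (kk * n))%:R * n%:R <= expR y.
  rewrite !natrM; apply: (@le_trans _ _ (expR t * (expR t * n%:R) * n%:R)).
    by rewrite ler_pM2r // ler_pM // ?mulr_ge0 // ler_pM2r.
  rewrite nE -!expRD ler_expR yt.
  have h : ln n%:R <= t / a by rewrite ler_pdivlMr // mulrC.
  have t0 : 0 < t by rewrite powR_gt0.
  have h2 : t * (2 + 2 / a) <= t * t by rewrite ler_pM2l.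
  move: (ln _) (t) (a) h h2 => {}x {}s {}b; clear; lra.
apply: (@le_trans _ _ n%:R^-1); last first.
  exact: inv_le_harmonic (ltnW n1).
rewrite -[leRHS]mul1r ler_pdivlMr // mulrAC.
apply: (@le_trans _ _ (expR y * expR (- y))); last by rewrite -expRD subrr expR0.
have q0 : 0 <= 1 + 3%:R * (1 - p) by rewrite addr_ge0 // mulr_ge0 // subr_ge0.
by apply: ler_pM => //; apply: divr_ge0; apply: exprn_ge0.
Qed.

(** The exponent [3 * g / 2] is reached on the whole range [0 < g < 1]; the three cases of the
    theorem are derived from it. *)
Lemma aas_lb_lt1 (g : R) (p : nat -> R) (k : nat -> nat) : 0 < g < 1 ->
  (forall n, 0 <= p n <= 1) ->
  (forall n, (0 < n)%N -> 1 - n%:R `^ (- g) <= p n) ->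
  (exists delta : nat -> R, (delta @ \oo --> (0 : R))%classic /\
     \forall n \near \oo%classic, (k n)%:R < expR (n%:R `^ delta n)) ->
  exists c : R, 0 < c /\ aas_lb p k (fun n => c * n%:R `^ (3 * g / 2)).
Proof.
move=> g01 p01 pn [delta [delta0 kn]]; have [g0 g1] := andP g01.
exists (ln 2 / 64 / 160 / 13); split; first by rewrite !divr_gt0 ?ln2_gt0.
apply: (squeeze_cvgr _ cvg_1_harmonic); last exact: cvg_cst.
pose a := (1 - g) / 2; have a0 : 0 < a by rewrite /a; lra.
have da : \forall n \near \oo%classic, delta n < a by exact: cvgr_lt delta0 _ a0.
near=> n.
have n1 : (1 < n)%N by near: n; exact: nbhs_infty_ge.
have kn' : (k n)%:R <= expR (n%:R `^ a).
  apply: (@le_trans _ _ (expR (n%:R `^ delta n))); first by apply: ltW; near: n.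
  rewrite ler_expR; apply: ler_powR; first by rewrite ler1n ltnW.
  by apply: ltW; near: n.
have tn : 2 + 2 / a <= n%:R `^ a by near: n; exact: near_powR_ge.
have xn : 2560 <= n%:R `^ g by near: n; exact: near_powR_ge.
apply/andP; split; last exact: gnpk_prob_le1.
have := @gnpk_prob_ge R n (k n) (p n) (p01 n) (ltnW n1) _ (max_nonadj g n)
  (fun w few => @refutation_lb_of_few_nonadj g n (k n) w g01 n1 xn few).
apply: le_trans; rewrite lerD2l lerN2.
by apply: (@many_nonadj_prob g _ _ _ a) => //; apply: pn; exact: ltnW.
Unshelve. all: by end_near.
Qed.

Lemma aas_lb_le (p : nat -> R) (k : nat -> nat) (f h : nat -> R) :
  (forall n, 0 <= p n <= 1) -> (\forall n \near \oo%classic, h n <= f n) ->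
  aas_lb p k f -> aas_lb p k h.
Proof.
move=> p01 hf; rewrite /aas_lb => fk.
apply: (squeeze_cvgr _ fk); last exact: cvg_cst.
near=> n; apply/andP; split; last exact: gnpk_prob_le1.
have hn : h n <= f n by near: n.
apply: ler_sum => w _; rewrite ler_wpM2l //.
  by case/andP: (p01 n) => p0 p1; rewrite mulr_ge0 // exprn_ge0 // subr_ge0.
case: ifPn => /asboolP fw; last by case: ifP.
by rewrite asboolT // => P /fw; exact: le_trans.
Unshelve. all: by end_near.
Qed.

End Asymptotics.

Local Open Scope classical_set_scope.

Theorem theorem5p1 (R : realType) (gamma : R) (p : nat -> R) (k : nat -> nat) :
  0 < gamma ->
  (forall n, 0 <= p n <= 1) ->
  (forall n, (0 < n)%N -> 1 - n%:R `^ (- gamma) <= p n) ->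
  (exists delta : nat -> R, delta @ \oo --> (0 : R) /\
     \forall n \near \oo, (k n)%:R < expR (n%:R `^ delta n)) ->
  [/\ gamma < 2^-1 ->
        exists c : R, 0 < c /\ aas_lb p k (fun n => c * n%:R `^ (3 * gamma / 2)),
      2^-1 <= gamma < 1 ->
        exists c : R, 0 < c /\
          aas_lb p k (fun n => c * n%:R `^ ((1 + gamma) / 2)
                                 / Num.sqrt (ln (k n * n)%:R))
    & 1 <= gamma ->
        forall eps : R, 0 < eps ->
          exists c : R, 0 < c /\ aas_lb p k (fun n => c * n%:R `^ (1 - eps))].
Proof.
move=> g0 p01 pn kn; split.
- by move=> g1; apply: aas_lb_lt1 => //; rewrite g0; lra.
- move=> /andP[g1 g2]; have [||||c [c0 lb]] := @aas_lb_lt1 R gamma p k => //.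
    by rewrite g0.
  exists c; split=> //; apply: aas_lb_le lb => //.
  near=> n.
  have n3 : (4 <= n)%N by near: n; exact: nbhs_infty_ge.
  rewrite -mulrA ler_pM2l //.
  (* [(1 + gamma) / 2 <= 3 * gamma / 2] holds as [gamma >= 1 / 2], and the denominator is at least 1
     for [n >= 4 > e]. *)
  apply: (@le_trans _ _ (n%:R `^ ((1 + gamma) / 2))); last first.
    by apply: ler_powR; [rewrite ler1n; lia|lra].
  (* For [k n = 0] the conventions [ln 0 = 0] and [0^-1 = 0] make the bound 0. *)
  have [kz|kz] := posnP (k n); first by rewrite kz mul0n ln0 // sqrtr0 invr0 mulr0 powR_ge0.
  have ln1 : 1 <= ln (k n * n)%:R :> R.
    rewrite -[leLHS]expRK ler_ln ?posrE ?expR_gt0 ?ltr0n ?muln_gt0 ?kz ?(leq_trans _ n3) //.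
    apply: le_trans (expR1_le4 R) _; rewrite ler_nat; exact: leq_trans (leq_pmull _ kz).
  have s1 : 1 <= Num.sqrt (ln (k n * n)%:R) :> R by rewrite -[leLHS]sqrtr1 ler_wsqrtr.
  by rewrite ler_piMr ?powR_ge0 // invf_le1 // (lt_le_trans ltr01 s1).
(* The exponent [2 / 3] satisfies [3 * (2 / 3) / 2 = 1], and [p n >= 1 - n^(- gamma) >= 1 - n^(- 2 /
   3)]. *)
- move=> g1 eps eps0; have [||||c [c0 lb]] := @aas_lb_lt1 R (2 / 3) p k => //.
  + by apply/andP; split; lra.
  + move=> n n1; apply: le_trans (pn n n1); rewrite lerD2l lerN2.
    by apply: ler_powR; [rewrite ler1n|lra].
  exists c; split=> //; apply: aas_lb_le lb => //.
  near=> n; have n1 : (0 < n)%N by near: n; exact: nbhs_infty_ge.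
  rewrite ler_pM2l //; apply: ler_powR; first by rewrite ler1n.
  lra.
Unshelve. all: by end_near.
Qed.
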